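(* The leading eigenvalue $k$ of $\widehat\mu$ is twice differentiable at $0$, with gradient $\nabla k(0)=\mathbf{i}\,m$ and Hessian matrix $\mathbf{H}_k(0)=-\sigma$.
   Context: Fix integers $d,p\ge 1$. Let $(Z_n)=(A_n,M_n)$ be a Markov-additive process on $\mathbb{Z}^d\times\{1,\dots,p\}$ (a Markov chain with $\mathbb{P}_{(x,i)}((A_1,M_1)=(x',i'))=\mathbb{P}_{(0,i)}((A_1,M_1)=(x'-x,i'))$), with jump matrix $\mu_{i,j}(x)=\mathbb{P}_{(0,i)}((A_1,M_1)=(x,j))$, assumed irreducible, aperiodic (for every state, the gcd of possible return times is $1$), with finite exponential moments ($\sum_xe^{\alpha\|x\|}\mu_{i,j}(x)<\infty$ for all $\alpha>0$). Fourier transform $\widehat\mu(\theta)_{i,j}=\sum_xe^{\mathbf{i}x\cdot\theta}\mu_{i,j}(x)$, $\theta\in\mathbb{R}^d$. For $\theta$ in a neighborhood of $0$, $\widehat\mu(\theta)$ has a unique eigenvalue of maximal modulus, which is simple; it is denoted $k(\theta)$ (with $k(0)=1$). $\pi$ is the stationary distribution of $\widehat\mu(0)$ (the transition matrix of $(M_n)$); local drifts $m_{i,j}=\sum_xx\mu_{i,j}(x)$, global drift $m=\sum_{i,j}\pi_im_{i,j}$. A change of section is a real $p\times d$ matrix $g$ with rows $g_i$; ${}^g\mu_{i,j}(x)=\mu_{i,j}(x+g_j-g_i)$ for $x\in\mathbb{R}^d$, ${}^gm_{i,j}=\sum_xx\,{}^g\mu_{i,j}(x)$; $g$ is appropriate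 if $\sum_j{}^gm_{i,j}=m$ for all $i$ (such $g$ exist and give the same ${}^g\mu$). The energy matrix is $\sigma_{k,l}=\sum_{x\in\mathbb{R}^d}x_kx_l\sum_{i,j}\pi_i\,{}^g\mu_{i,j}(x)$ for $g$ appropriate. *)

(* Defs.v *)
From HB Require Import structures.
From mathcomp Require Import all_boot all_order all_algebra.
From mathcomp Require Import all_classical all_reals all_analysis.
From mathcomp Require Import complex.
Set Implicit Arguments. Unset Strict Implicit. Unset Printing Implicit Defensive.
Import Order.TTheory GRing.Theory Num.Theory.
Import numFieldNormedType.Exports.
Local Open Scope ring_scope.
Local Open Scope classical_set_scope.

(* Lattice points of Z^d are row vectors 'rV[int]_d; the modulating set
   {1,...,p} is 'I_p.  A jump "matrix" is
     mu : 'I_p -> 'I_p -> 'rV[int]_d -> R,   mu i j x = P_(0,i)((A_1,M_1) = (x,j)). *)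

Section MAP.
Variable R : realType.

Definition zr (d : nat) (x : 'rV[int]_d) : 'rV[R]_d := map_mx (fun z : int => z%:~R) x.

Definition l1norm (d : nat) (x : 'rV[int]_d) : R := \sum_(k < d) `|(x 0 k)%:~R : R|.

Definition dotz (d : nat) (x : 'rV[int]_d) (t : 'rV[R]_d) : R :=
  \sum_(k < d) (x 0 k)%:~R * t 0 k.

(* Sum of a (absolutely summable) real family indexed by a countable type:
   sum of the positive part minus sum of the negative part. *)
Definition rsum (T : choiceType) (f : T -> R) : R :=
  fine (\esum_(x in [set: T]) (Num.max (f x) 0)%:E)
  - fine (\esum_(x in [set: T]) (Num.max (- f x) 0)%:E).

Variables (d p : nat) (mu : 'I_p -> 'I_p -> 'rV[int]_d -> R).

Definition is_MAP_kernel : Prop :=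
  (forall i j x, 0 <= mu i j x) /\
  (forall i, (\sum_(j < p) \esum_(x in [set: 'rV[int]_d]) (mu i j x)%:E = 1)%E).

Definition exp_moments : Prop :=
  forall (alpha : R), 0 < alpha -> forall i j,
    (\esum_(x in [set: 'rV[int]_d]) (expR (alpha * l1norm x) * mu i j x)%:E < +oo)%E.

(* possible n-step transitions of the chain Z_n = (A_n, M_n) on Z^d x {1..p}:
   reach n z z' <-> P_z(Z_n = z') > 0 *)
Fixpoint reach (n : nat) (z z' : 'rV[int]_d * 'I_p) : Prop :=
  match n with
  | 0 => z = z'
  | n'.+1 => exists w, reach n' z w /\ 0 < mu w.2 z'.2 (z'.1 - w.1)
  end.

Definition MAP_irreducible : Prop :=
  forall z z' : 'rV[int]_d * 'I_p, exists n, reach n z z'.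

(* for every state, the gcd of the possible return times is 1, i.e. the only
   common divisor of all possible return times is 1 *)
Definition MAP_aperiodic : Prop :=
  forall (z : 'rV[int]_d * 'I_p) (c : nat),
    (forall n, (0 < n)%N -> reach n z z -> (c %| n)%N) -> c = 1%N.

Definition muhat (t : 'rV[R]_d) : 'M[R[i]]_p :=
  \matrix_(i, j) Complex (rsum (fun x : 'rV[int]_d => cos (dotz x t) * mu i j x))
                         (rsum (fun x : 'rV[int]_d => sin (dotz x t) * mu i j x)).

Definition transM : 'M[R]_p := \matrix_(i, j) rsum (mu i j).

Definition stationary (pi : 'rV[R]_p) : Prop :=
  (forall i, 0 <= pi 0 i) /\ \sum_(i < p) pi 0 i = 1 /\ pi *m transM = pi.

Definition local_drift (i j : 'I_p) : 'rV[R]_d :=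
  \row_k rsum (fun x : 'rV[int]_d => (x 0 k)%:~R * mu i j x).

Definition drift (pi : 'rV[R]_p) : 'rV[R]_d :=
  \sum_(i < p) \sum_(j < p) pi 0 i *: local_drift i j.

(* change of section g (rows g_i) : ^g mu_{ij}(y) = mu_{ij}(y + g_j - g_i).
   The mass mu_{ij}(x), x in Z^d, sits in ^g mu_{ij} at the point
   gpt g i j x = x - g_j + g_i of R^d (^g mu_{ij} vanishes elsewhere). *)
Definition gpt (g : 'M[R]_(p, d)) (i j : 'I_p) (x : 'rV[int]_d) : 'rV[R]_d :=
  zr x - row j g + row i g.

(* ^g m_{ij} = sum_{y in R^d} y ^g mu_{ij}(y) *)
Definition glocal_drift (g : 'M[R]_(p, d)) (i j : 'I_p) : 'rV[R]_d :=
  \row_k rsum (fun x : 'rV[int]_d => gpt g i j x 0 k * mu i j x).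

Definition appropriate (pi : 'rV[R]_p) (g : 'M[R]_(p, d)) : Prop :=
  forall i, \sum_(j < p) glocal_drift g i j = drift pi.

(* energy matrix sigma_{kl} = sum_{y in R^d} y_k y_l sum_{ij} pi_i ^g mu_{ij}(y) *)
Definition energy (pi : 'rV[R]_p) (g : 'M[R]_(p, d)) : 'M[R]_d :=
  \matrix_(k, l) \sum_(i < p) \sum_(j < p)
     pi 0 i * rsum (fun x : 'rV[int]_d => gpt g i j x 0 k * gpt g i j x 0 l * mu i j x).

End MAP.

Section Spectral.
Variable R : realType.

Definition leading_eigenvalue (p : nat) (A : 'M[R[i]]_p) (l : R[i]) : Prop :=
  eigenvalue A l /\ mup l (char_poly A) = 1%N /\
  (forall l', eigenvalue A l' -> l' != l -> `|l'| < `|l|).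

Definition grad (d : nat) (f : 'rV[R]_d -> R) (t : 'rV[R]_d) : 'rV[R]_d :=
  \row_l ('d f t (delta_mx 0 l)).

Definition twice_differentiable (d : nat) (f : 'rV[R]_d -> R) (t0 : 'rV[R]_d) : Prop :=
  (\forall t \near t0, differentiable f t) /\ differentiable (grad f) t0.

Definition hessian (d : nat) (f : 'rV[R]_d -> R) (t0 : 'rV[R]_d) : 'M[R]_d :=
  \matrix_(k, l) ('d (grad f) t0 (delta_mx 0 k) 0 l).

End Spectral.

(* Main.v *)
Require Import Defs.
From HB Require Import structures.
From mathcomp Require Import all_boot all_order all_algebra.
From mathcomp Require Import all_classical all_reals all_analysis.
From mathcomp Require Import complex.
From mathcomp Require Import ring lra.
Set Implicit Arguments. Unset Strict Implicit. Unset Printing Implicit Defensive.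
Import Order.TTheory GRing.Theory Num.Theory.
Import numFieldNormedType.Exports.
Import Normc.
Local Open Scope ring_scope.

(** Conjugating the Fourier transform of [mu] by the diagonal matrix of entries
    [exp(i g_i.t)] does not change its spectrum and gives a matrix [B t] whose
    entries are the Fourier transforms of the gauged kernel.  Let [e] be the
    constant column 1.

    At [t = 0], [B 0] is the transition matrix of the modulating chain: a
    peripheral eigenvector has constant modulus and is multiplied by the
    eigenvalue along every possible transition, so that irreducibility and
    aperiodicity leave only the eigenvalue 1 with eigenvector [e].  Hence
    [1 - B 0 + e pi] is invertible, with inverse [S].

    Let [v] and [l] be right and left eigenvectors of [B t] for an eigenvalue [z]
    near 1, normalized by [pi v = 1] and [l e = 1].  They satisfy
    [v = e + S ((1 - z) + (B t - B 0)) v] and its mirror image, so [v] is close to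
    [e], [l] to [pi] and [l v] to 1.  This gives uniqueness and simplicity of the
    eigenvalue near 1.  It exists because [det (1 - B t)] is small, and the
    Cayley-Hamilton theorem for [B 0] confines the other eigenvalues to a smaller
    disc.

    Everything else follows from the identity
      [(k s - k t) l(t) v(s) = l(t) (B s - B t) v(s)].
    It makes [k] Lipschitz, then differentiable with
    [dk = l (dB) v / (l v)].  As [g] is appropriate, [dB(0) e = i m e], whence
    [v = e + O(t^2)] and [l = pi + O(t)], and therefore
    [dk(t) = i m - sigma t + O(t^2)]. *)

(** * Real and imaginary parts, and the modulus as a real number *)

Section ComplexModulus.
Variable R : realType.
Implicit Types (z w : R[i]) (a b : R).

Lemma normcE z : `|z| = (normc z)%:C%C.
Proof. by case: z. Qed.

Lemma ReD z w : complex.Re (z + w) = complex.Re z + complex.Re w.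
Proof. by case: z; case: w. Qed.

Lemma ImD z w : complex.Im (z + w) = complex.Im z + complex.Im w.
Proof. by case: z; case: w. Qed.

Lemma Re_sum (I : Type) (r : seq I) (P : pred I) (F : I -> R[i]) :
  complex.Re (\sum_(i <- r | P i) F i) = \sum_(i <- r | P i) complex.Re (F i).
Proof. by elim/big_ind2: _ => [//|x1 x2 y1 y2 <- <-|//]; rewrite ReD. Qed.

Lemma Im_sum (I : Type) (r : seq I) (P : pred I) (F : I -> R[i]) :
  complex.Im (\sum_(i <- r | P i) F i) = \sum_(i <- r | P i) complex.Im (F i).
Proof. by elim/big_ind2: _ => [//|x1 x2 y1 y2 <- <-|//]; rewrite ImD. Qed.

Lemma ReZ a z : complex.Re (a%:C%C * z) = a * complex.Re z.
Proof. by case: z => x y /=; rewrite mul0r subr0. Qed.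

Lemma ImZ a z : complex.Im (a%:C%C * z) = a * complex.Im z.
Proof. by case: z => x y /=; rewrite mul0r addr0. Qed.

Lemma normc_ge0 z : 0 <= normc z.
Proof. by case: z => a b; rewrite /normc sqrtr_ge0. Qed.

Lemma normc_eq0 z : (normc z == 0) = (z == 0).
Proof.
apply/eqP/eqP => [/eq0_normc//|->]; exact: normc0.
Qed.

Lemma normc_sum (I : Type) (r : seq I) (P : pred I) (F : I -> R[i]) :
  normc (\sum_(i <- r | P i) F i) <= \sum_(i <- r | P i) normc (F i).
Proof.
elim/big_ind2: _ => [|x1 x2 y1 y2 h1 h2|//]; first by rewrite normc0.
exact: le_trans (le_normcD _ _) (lerD h1 h2).
Qed.

Lemma normcB z w : normc (z - w) <= normc z + normc w.
Proof. by rewrite -(normcN w) le_normcD. Qed.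

Lemma normc_distC z w : normc (z - w) = normc (w - z).
Proof. by rewrite -normcN opprB. Qed.

Lemma normc_real a : normc a%:C%C = `|a|.
Proof. by rewrite /normc /= expr0n /= addr0 sqrtr_sqr. Qed.

Lemma normc_imag a : normc ('i%C * a%:C%C) = `|a|.
Proof. by rewrite normcM normc_real /normc /= expr0n /= expr1n add0r sqrtr1 mul1r. Qed.

Lemma normc_expi a : normc (Complex (cos a) (sin a)) = 1.
Proof. by rewrite /normc cos2Dsin2 sqrtr1. Qed.

Lemma sqr_normc z : normc z ^+ 2 = complex.Re z ^+ 2 + complex.Im z ^+ 2.
Proof. by case: z => a b; rewrite /normc sqr_sqrtr// addr_ge0// sqr_ge0. Qed.

Lemma ler_Re_normc z : `|complex.Re z| <= normc z.
Proof.
rewrite -(ler_pXn2r (n := 2))// ?nnegrE ?normc_ge0//.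
by rewrite sqr_normc -normrX ger0_norm ?sqr_ge0// lerDl sqr_ge0.
Qed.

Lemma ler_Im_normc z : `|complex.Im z| <= normc z.
Proof.
rewrite -(ler_pXn2r (n := 2))// ?nnegrE ?normc_ge0//.
by rewrite sqr_normc -normrX ger0_norm ?sqr_ge0// lerDr sqr_ge0.
Qed.

Lemma normc_le z : normc z <= `|complex.Re z| + `|complex.Im z|.
Proof.
rewrite {1}[z]complexE; apply: le_trans (le_normcD _ _) _.
by rewrite normc_real normc_imag.
Qed.

End ComplexModulus.

(** * The entrywise l1 norm of complex matrices *)

Section EntrywiseNorm.
Variable R : realType.
Local Notation C := R[i].

(** This norm is submultiplicative for rectangular products with no dimension factor, so a single
    norm serves rows, columns and square matrices. *)
Definition mxl1 m n (X : 'M[C]_(m, n)) : R := \sum_i \sum_j normc (X i j).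

Lemma mxl1_ge0 m n (X : 'M[C]_(m, n)) : 0 <= mxl1 X.
Proof. by rewrite sumr_ge0// => i _; rewrite sumr_ge0// => j _; exact: normc_ge0. Qed.

Lemma mxl1_entry m n (X : 'M[C]_(m, n)) i j : normc (X i j) <= mxl1 X.
Proof.
rewrite /mxl1 (bigD1 i)//= (bigD1 j)//= -addrA lerDl addr_ge0//.
  by rewrite sumr_ge0// => k _; exact: normc_ge0.
by rewrite sumr_ge0// => k _; rewrite sumr_ge0// => l _; exact: normc_ge0.
Qed.

Lemma mxl10 m n : mxl1 (0 : 'M[C]_(m, n)) = 0.
Proof. by rewrite /mxl1 big1// => i _; rewrite big1// => j _; rewrite mxE normc0. Qed.

Lemma mxl1_eq0 m n (X : 'M[C]_(m, n)) : (mxl1 X == 0) = (X == 0).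
Proof.
apply/eqP/eqP => [X0|->]; last exact: mxl10.
apply/matrixP => i j; rewrite mxE; apply/eqP; rewrite -normc_eq0.
by rewrite eq_le normc_ge0 -{1}X0 mxl1_entry.
Qed.

Lemma mxl1_gt0 m n (X : 'M[C]_(m, n)) : (0 < mxl1 X) = (X != 0).
Proof. by rewrite lt0r mxl1_ge0 andbT mxl1_eq0. Qed.

Lemma mxl1D m n (X Y : 'M[C]_(m, n)) : mxl1 (X + Y) <= mxl1 X + mxl1 Y.
Proof.
rewrite /mxl1 -big_split/= ler_sum// => i _; rewrite -big_split/= ler_sum// => j _.
by rewrite mxE le_normcD.
Qed.

Lemma mxl1N m n (X : 'M[C]_(m, n)) : mxl1 (- X) = mxl1 X.
Proof.
by apply: eq_bigr => i _; apply: eq_bigr => j _; rewrite mxE normcN.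
Qed.

Lemma mxl1B m n (X Y : 'M[C]_(m, n)) : mxl1 (X - Y) <= mxl1 X + mxl1 Y.
Proof. by rewrite -(mxl1N Y) mxl1D. Qed.

Lemma mxl1Z m n a (X : 'M[C]_(m, n)) : mxl1 (a *: X) = normc a * mxl1 X.
Proof.
rewrite /mxl1 mulr_sumr; apply: eq_bigr => i _; rewrite mulr_sumr.
by apply: eq_bigr => j _; rewrite mxE normcM.
Qed.

Lemma mxl1_sum m n (I : Type) (r : seq I) (P : pred I) (F : I -> 'M[C]_(m, n)) :
  mxl1 (\sum_(i <- r | P i) F i) <= \sum_(i <- r | P i) mxl1 (F i).
Proof.
elim/big_ind2: _ => [|x1 x2 y1 y2 h1 h2|//]; first by rewrite mxl10.
exact: le_trans (mxl1D _ _) (lerD h1 h2).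
Qed.

Lemma mxl1M m n q (X : 'M[C]_(m, n)) (Y : 'M[C]_(n, q)) :
  mxl1 (X *m Y) <= mxl1 X * mxl1 Y.
Proof.
rewrite [X in _ <= X * _]/mxl1 mulr_suml ler_sum// => i _.
apply: (@le_trans _ _ (\sum_j \sum_k normc (X i k) * normc (Y k j))).
  apply: ler_sum => j _; rewrite mxE; apply: le_trans (normc_sum _ _ _) _.
  by apply: ler_sum => k _; rewrite normcM.
rewrite exchange_big/= mulr_suml ler_sum// => k _; rewrite -mulr_sumr.
rewrite ler_wpM2l ?normc_ge0// /mxl1 [X in _ <= X](bigD1 k)//= lerDl.
by rewrite sumr_ge0// => l _; rewrite sumr_ge0// => j _; exact: normc_ge0.
Qed.

Lemma mxl1_le m n (X : 'M[C]_(m, n)) K :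
  (forall i j, normc (X i j) <= K) -> mxl1 X <= (m * n)%:R * K.
Proof.
move=> XK; apply: (@le_trans _ _ (\sum_(i < m) \sum_(j < n) K)).
  by apply: ler_sum => i _; apply: ler_sum => j _; exact: XK.
by rewrite !sumr_const !card_ord -mulrnA mulr_natl mulnC.
Qed.

Lemma mxl111 (X : 'M[C]_1) : mxl1 X = normc (X 0 0).
Proof. by rewrite /mxl1 !big_ord1. Qed.

End EntrywiseNorm.

(** * Peripheral spectrum of the modulating chain *)

Section Peripheral.
Variable R : realType.
Local Notation C := R[i].

Lemma map_mulmx_col m n (P : 'M[R]_(m, n)) (v : 'cV[C]_n) i :
  (map_mx (real_complex R) P *m v) i 0 = \sum_j (P i j)%:C%C * v j 0.
Proof. by rewrite mxE; apply: eq_bigr => j _; rewrite mxE. Qed.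

(* The variance of the values v_j under the i-th row of P is nonpositive. *)
Lemma stochastic_eigen_step p (P : 'M[R]_p) (v : 'cV[C]_p) (l : C) (m : R) i j :
  (forall i j, 0 <= P i j) -> (forall i, \sum_j P i j = 1) ->
  map_mx (real_complex R) P *m v = l *: v ->
  (forall j, normc (v j 0) <= m) -> normc (v i 0) = m -> 1 <= normc l ->
  0 < P i j -> v j 0 = l * v i 0.
Proof.
move=> P0 P1 Pv vm vi l1 Pij; set w := l * v i 0.
have m0 : 0 <= m by rewrite -vi normc_ge0.
have hw : w = \sum_j (P i j)%:C%C * v j 0.
  by rewrite -map_mulmx_col Pv mxE.
have hRe : complex.Re w = \sum_j P i j * complex.Re (v j 0).
  by rewrite hw Re_sum; apply: eq_bigr => k _; rewrite ReZ.
have hIm : complex.Im w = \sum_j P i j * complex.Im (v j 0).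
  by rewrite hw Im_sum; apply: eq_bigr => k _; rewrite ImZ.
have wm : m <= normc w by rewrite normcM vi ler_peMl.
have S0 : \sum_k P i k * normc (w - v k 0) ^+ 2 <= 0.
  have -> : \sum_k P i k * normc (w - v k 0) ^+ 2 =
     \sum_k (P i k * normc w ^+ 2 - 2 * complex.Re w * (P i k * complex.Re (v k 0))
             - 2 * complex.Im w * (P i k * complex.Im (v k 0))
             + P i k * normc (v k 0) ^+ 2).
    apply: eq_bigr => k _; rewrite !sqr_normc.
    by case: (w) => a b; case: (v k 0) => a' b' /=; ring.
  rewrite big_split/= !sumrB -!mulr_sumr -hRe -hIm -mulr_suml P1 mul1r.
  have : \sum_k P i k * normc (v k 0) ^+ 2 <= m ^+ 2.
    rewrite -[leRHS]mul1r -(P1 i) mulr_suml ler_sum// => k _.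
    by rewrite ler_wpM2l// lerXn2r ?nnegrE ?normc_ge0.
  have : m ^+ 2 <= normc w ^+ 2 by rewrite lerXn2r ?nnegrE ?normc_ge0.
  by rewrite !sqr_normc; nra.
have h0 k : 0 <= P i k * normc (w - v k 0) ^+ 2.
  by rewrite mulr_ge0// exprn_ge0// normc_ge0.
have /psumr_eq0P : \sum_k P i k * normc (w - v k 0) ^+ 2 = 0.
  by apply/eqP; rewrite eq_le S0 sumr_ge0.
move=> /(_ (fun k _ => h0 k)) /(_ j isT) /eqP.
rewrite mulf_eq0 gt_eqF//= sqrf_eq0 normc_eq0 subr_eq0.
by move/eqP.
Qed.

(** Start at an index where the modulus of v is maximal. Each possible transition keeps it maximal
    and multiplies the entry by l, so every return time n satisfies l^n = 1. The order of l divides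
    all return times, hence is 1 by aperiodicity; irreducibility then carries the same value to
    every index. *)
Lemma MAP_peripheral_eigen d p (mu : 'I_p -> 'I_p -> 'rV[int]_d -> R)
    (P : 'M[R]_p) (v : 'cV[C]_p) (l : C) :
  (forall i j, 0 <= P i j) -> (forall i, \sum_j P i j = 1) ->
  (forall i j x, 0 < mu i j x -> 0 < P i j) ->
  MAP_irreducible mu -> MAP_aperiodic mu ->
  map_mx (real_complex R) P *m v = l *: v -> v != 0 -> 1 <= normc l ->
  l = 1 /\ exists a, v = const_mx a.
Proof.
move=> P0 P1 muP irr aper Pv v0 l1.
have [i0 vi0 vmax] : exists2 i, v i 0 != 0 & forall j, normc (v j 0) <= normc (v i 0).
  have [i vi] : exists i, v i 0 != 0.
    apply/existsP; apply: contraNT v0 => /existsPn v0.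
    by apply/eqP/matrixP => i j; rewrite ord1 mxE; apply/eqP; rewrite -[_ == _]negbK v0.
  case: (@Order.TotalTheory.arg_maxP _ _ _ i predT (fun j => normc (v j 0)) isT) => k _ hk.
  exists k => [|j]; last exact: hk.
  by rewrite -normc_eq0 gt_eqF// (lt_le_trans _ (hk i isT))// lt0r normc_ge0 normc_eq0 vi.
pose m := normc (v i0 0).
have hr n z z' : reach mu n z z' -> normc (v z.2 0) = m ->
    v z'.2 0 = l ^+ n * v z.2 0 /\ normc (v z'.2 0) = m.
  elim: n z' => [z' <- //|n IH z' [w [rzw wz']] vz]; first by rewrite mul1r.
  have [IH1 IH2] := IH _ rzw vz.
  have step := stochastic_eigen_step P0 P1 Pv vmax IH2 l1 (muP _ _ _ wz').
  split; first by rewrite step IH1 exprS mulrA.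
  apply/eqP; rewrite eq_le vmax /= step normcM IH2.
  by rewrite ler_peMl// normc_ge0.
have ret n : reach mu n (0, i0) (0, i0) -> l ^+ n = 1.
  move=> /hr /(_ erefl) /= [h _]; apply: (mulIf vi0).
  by rewrite mul1r -h.
have l_eq1 : l = 1.
  have [n n0 rn] : exists2 n, (0 < n)%N & reach mu n (0, i0) (0, i0).
    (* Irreducibility may give only the path of length 0. Without a positive return time, 2 would
       vacuously divide all of them, against aperiodicity. *)
    apply: contrapT => noret; have := aper (0, i0) 2%N.
    suff h : forall n, (0 < n)%N -> reach mu n (0, i0) (0, i0) -> (2 %| n)%N by move=> /(_ h).
    by move=> n n0 rn; case: noret; exists n.
  have [c primc _] := prim_order_exists n0 (ret _ rn).
  have c1 : c = 1%N.
    by apply: (aper (0, i0)) => k _ rk; rewrite (prim_order_dvd primc) ret.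
  by have := prim_expr_order primc; rewrite c1 expr1.
split => //; exists (v i0 0); apply/matrixP => j k; rewrite ord1 mxE.
have [n /hr /(_ erefl) /= [-> _]] := irr (0, i0) (0, j).
by rewrite l_eq1 expr1n mul1r.
Qed.

End Peripheral.

(** * Rank-one deflation, left and right eigenvectors, Cayley-Hamilton products *)

Section RankOneDeflation.

(** The determinant of the bordered matrix [K] is computed twice: by eliminating the block [u] below
    the corner 1, and by clearing that block through a multiplication on the right. The factor [Y]
    on the left avoids both a division and the exponent n - 1. *)
Lemma det_scalar_add_rank1 (A : idomainType) n (Y : A) (u : 'cV[A]_n) (w : 'rV[A]_n) :
  Y * \det (Y%:M + u *m w) = (Y + (w *m u) 0 0) * Y ^+ n.
Proof.
pose K := block_mx (1%:M : 'M[A]_1) (- w) u (Y%:M).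
have hK : K = block_mx 1%:M 0 u 1%:M *m block_mx 1%:M (- w) 0 (Y%:M + u *m w).
  by rewrite mulmx_block !mul1mx !mulmx1 !mul0mx !addr0 mulmxN addrCA addNr addr0.
have detK : \det K = \det (Y%:M + u *m w).
  by rewrite hK det_mulmx det_lblock det_ublock !det1 !mul1r.
have : K *m block_mx Y%:M 0 (- u) 1%:M = block_mx (Y%:M + w *m u) (- w) 0 Y%:M.
  rewrite mulmx_block !mul1mx !mulmx1 !mulmx0 !mulmxN !mulNmx opprK add0r.
  by rewrite add0r mul_mx_scalar mul_scalar_mx subrr.
move/(congr1 determinant).
rewrite det_mulmx det_lblock det_ublock det1 mulr1 !det_scalar detK det_mx11 expr1.
by rewrite !mxE eqxx mulr1n mulrC.
Qed.

Variable F : fieldType.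

(** Deflation moves the eigenvalue k to k - 1 and keeps the rest of the spectrum. With Y = X - k,
    the relation (X - B) v = Y v gives (X - B)(Y + v w) = Y (X - B + v w); take determinants and
    cancel Y^n. *)
Lemma char_poly_deflate n (B : 'M[F]_n) (v : 'cV[F]_n) (w : 'rV[F]_n) k :
  B *m v = k *: v -> w *m v = 1%:M ->
  char_poly B * ('X - k%:P + 1) = ('X - k%:P) * char_poly (B - v *m w).
Proof.
move=> Bv wv; pose Y : {poly F} := 'X - k%:P.
pose vp := map_mx (@polyC F) v; pose wp := map_mx (@polyC F) w.
have Y0 : Y != 0 by rewrite polyXsubC_eq0.
have hv : char_poly_mx B *m vp = Y *: vp.
  rewrite /char_poly_mx mulmxBl mul_scalar_mx -map_mxM Bv scalerBl.
  by rewrite map_mxZ.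
have hw : (wp *m vp) 0 0 = 1 by rewrite -map_mxM wv !mxE.
have hm : char_poly_mx B *m (Y%:M + vp *m wp) = Y *: char_poly_mx (B - v *m w).
  rewrite mulmxDr mul_mx_scalar mulmxA hv -scalemxAl -scalerDr; congr (_ *: _).
  by rewrite /char_poly_mx map_mxB map_mxM opprB addrA addrAC.
have /(congr1 (fun x => Y * x)) := congr1 determinant hm.
rewrite det_mulmx detZ mulrCA det_scalar_add_rank1 hw => h.
apply: (mulIf (expf_neq0 n Y0)); rewrite -[LHS]mulrA [LHS]h.
by rewrite mulrA mulrAC.
Qed.

(** Compare the multiplicities of k on both sides of the deflation identity: X - k + 1 takes the
    value 1 at k, and the deflated polynomial does not vanish there. *)
Lemma mup_char_poly_simple n (B : 'M[F]_n) (v : 'cV[F]_n) (w : 'rV[F]_n) k :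
  B *m v = k *: v -> w *m v = 1%:M -> ~~ eigenvalue (B - v *m w) k ->
  mup k (char_poly B) = 1%N.
Proof.
move=> Bv wv nk; have h := char_poly_deflate Bv wv.
rewrite -(@mupMl _ k _ ('X - k%:P + 1)); last first.
  by rewrite rootE !hornerE subrr add0r oner_eq0.
rewrite h mupMl; last by rewrite -eigenvalue_root_char.
by have := mup_XsubCX 1 k k; rewrite expr1 eqxx.
Qed.

Lemma char_poly_conj n (A B D : 'M[F]_n) : D \in unitmx -> D *m A = B *m D ->
  char_poly A = char_poly B.
Proof.
move=> uD DA; pose Dp := map_mx (@polyC F) D.
have hD : Dp *m char_poly_mx A = char_poly_mx B *m Dp.
  by rewrite /char_poly_mx mulmxBr mulmxBl -!map_mxM DA mul_mx_scalar mul_scalar_mx.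
have D0 : \det Dp != 0.
  by rewrite det_map_mx polyC_eq0 -unitfE -unitmxE.
apply: (mulfI D0); rewrite /char_poly -det_mulmx hD det_mulmx mulrC.
by [].
Qed.

Lemma eigenvalue_trmx n (B : 'M[F]_n) k : eigenvalue B^T k = eigenvalue B k.
Proof.
rewrite !eigenvalue_root_char; congr (root _ _).
rewrite /char_poly -[RHS]det_tr; congr (\det _).
by rewrite /char_poly_mx linearB/= tr_scalar_mx map_trmx.
Qed.

Lemma eigenvalue_colP n (B : 'M[F]_n) k :
  reflect (exists2 v : 'cV[F]_n, B *m v = k *: v & v != 0) (eigenvalue B k).
Proof.
rewrite -eigenvalue_trmx; apply: (iffP (@eigenvalueP _ _ _ _)) => -[v hv v0].
  exists v^T; last by rewrite trmx_eq0.
  by apply: trmx_inj; rewrite trmx_mul trmxK hv linearZ/= trmxK.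
exists v^T; last by rewrite trmx_eq0.
by rewrite -trmx_mul hv linearZ.
Qed.

Lemma horner_char_poly n (B : 'M[F]_n) z : (char_poly B).[z] = \det (z%:M - B).
Proof.
rewrite /char_poly -[LHS]/(horner_eval z _) -det_map_mx; congr (\det _).
apply/matrixP => i j; rewrite !mxE /= /horner_eval.
by rewrite hornerD hornerN hornerC hornerMn hornerX.
Qed.

(** Here [s] stays fixed while [B] varies: for [s] the spectrum of [B 0] the product vanishes at
    [B 0] by Cayley-Hamilton, hence is small at [B t], where an eigenvector for k is scaled by the
    product of the k - z. *)
Definition mxprod_sub n (s : seq F) (B : 'M[F]_n) : 'M[F]_n :=
  foldr (fun z X => (B - z%:M) *m X) 1%:M s.

Lemma mxprod_sub_char_poly n (s : seq F) (B : 'M[F]_n) :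
  char_poly B = \prod_(z <- s) ('X - z%:P) -> mxprod_sub s B = 0.
Proof.
case: n B => [|n] B h; first by apply/matrixP => -[].
rewrite -(Cayley_Hamilton B) h; elim: s {h} => [|z s IH].
  by rewrite big_nil rmorph1.
rewrite big_cons rmorphM /= IH rmorphB /= horner_mx_X horner_mx_C.
by [].
Qed.

Lemma eigen_mxprod_sub n (s : seq F) (B : 'M[F]_n) (u : 'rV[F]_n) k :
  u *m B = k *: u ->
  u *m mxprod_sub s B = (\prod_(z <- s) ('X - z%:P)).[k] *: u.
Proof.
move=> uB; elim: s => [|z s IH] /=; first by rewrite mulmx1 big_nil hornerC scale1r.
rewrite mulmxA mulmxBr uB mul_mx_scalar -scalerBl -scalemxAl IH scalerA.
by rewrite big_cons hornerM hornerXsubC.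
Qed.

End RankOneDeflation.

(** * Lipschitz estimates based at the origin *)

Section LipschitzAt0.
Variables (R : realType) (d : nat).
Local Notation C := R[i].
Local Notation V := 'rV[R]_d.

(** Comparing with the value at 0 on the unit ball only, this property is stable under sums and
    products, so it passes from the entries of [B t] to every polynomial in them. *)
Definition lip0 (f : V -> C) : Prop :=
  exists2 K : R, 0 <= K &
    forall t : V, `|t| <= 1 -> normc (f t - f 0) <= K * `|t|.

Lemma lip0_cst c : lip0 (fun=> c).
Proof. by exists 0 => // t _; rewrite subrr normc0 mul0r. Qed.

Lemma lip0D f g : lip0 f -> lip0 g -> lip0 (fun t => f t + g t).
Proof.
move=> [K K0 hf] [L L0 hg]; exists (K + L); first by rewrite addr_ge0.
move=> t t1; rewrite mulrDl.
have -> : f t + g t - (f 0 + g 0) = (f t - f 0) + (g t - g 0) by ring.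
exact: le_trans (le_normcD _ _) (lerD (hf _ t1) (hg _ t1)).
Qed.

Lemma lip0M f g : lip0 f -> lip0 g -> lip0 (fun t => f t * g t).
Proof.
move=> [K K0 hf] [L L0 hg]; exists (K * (L + normc (g 0)) + normc (f 0) * L).
  by rewrite addr_ge0// mulr_ge0// ?addr_ge0 ?normc_ge0.
move=> t t1.
have -> : f t * g t - f 0 * g 0 = (f t - f 0) * (g t - g 0 + g 0) + f 0 * (g t - g 0) by ring.
apply: le_trans (le_normcD _ _) _; rewrite !normcM mulrDl lerD//; last first.
  by rewrite -mulrA ler_wpM2l ?normc_ge0 ?hg.
rewrite mulrAC; apply: ler_pM; rewrite ?normc_ge0 ?hf//.
apply: le_trans (le_normcD _ _) _; rewrite lerD2r; apply: le_trans (hg _ t1) _.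
by rewrite ler_piMr.
Qed.

Lemma lip0_sum (I : Type) (r : seq I) (P : pred I) (F : I -> V -> C) :
  (forall i, lip0 (F i)) -> lip0 (fun t => \sum_(i <- r | P i) F i t).
Proof.
move=> hF; elim: r => [|i r IH].
  by under eq_fun do rewrite big_nil; exact: lip0_cst.
under eq_fun do rewrite big_cons; case: (P i) => //.
exact: lip0D.
Qed.

Lemma lip0_prod (I : Type) (r : seq I) (P : pred I) (F : I -> V -> C) :
  (forall i, lip0 (F i)) -> lip0 (fun t => \prod_(i <- r | P i) F i t).
Proof.
move=> hF; elim: r => [|i r IH].
  by under eq_fun do rewrite big_nil; exact: lip0_cst.
under eq_fun do rewrite big_cons; case: (P i) => //.
exact: lip0M.
Qed.

Variables (p : nat) (B : V -> 'M[C]_p).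
Hypothesis lipB : forall i j, lip0 (fun t => B t i j).

Lemma lip0_det z : lip0 (fun t => \det (z%:M - B t)).
Proof.
apply: lip0_sum => s; apply: lip0M; first exact: lip0_cst.
apply: lip0_prod => i; under eq_fun do rewrite !mxE.
apply: lip0D; first exact: lip0_cst.
under eq_fun do rewrite -mulN1r.
by apply: lip0M; [exact: lip0_cst|exact: lipB].
Qed.

Lemma lip0_mxprod_sub s i j : lip0 (fun t => mxprod_sub s (B t) i j).
Proof.
elim: s i j => [|z s IH] i j /=; first exact: lip0_cst.
under eq_fun do rewrite mxE.
apply: lip0_sum => k; apply: lip0M => //.
under eq_fun do rewrite !mxE.
by apply: lip0D; [exact: lipB|exact: lip0_cst].
Qed.

End LipschitzAt0.

(** * Roots of the characteristic polynomial and the spectral gap *)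

Section RootSeparation.
Variable R : realType.
Local Notation C := R[i].

Lemma char_poly_roots p (B : 'M[C]_p) :
  exists s : seq C, [/\ size s = p, char_poly B = \prod_(z <- s) ('X - z%:P) &
    forall z, (z \in s) = eigenvalue B z].
Proof.
have [s hs] := closed_field_poly_normal (char_poly B).
rewrite (monicP (char_poly_monic B)) scale1r in hs.
exists s; split => // [|z]; last by rewrite eigenvalue_root_char hs root_prod_XsubC.
by have := size_char_poly B; rewrite hs size_prod_XsubC => -[].
Qed.

Lemma normc_prod_XsubC_ge (s : seq C) (x : C) (e : R) : 0 <= e ->
  (forall z, z \in s -> e <= normc (x - z)) ->
  e ^+ size s <= normc (\prod_(z <- s) ('X - z%:P)).[x].
Proof.
move=> e0; elim: s => [|z s IH] hs; first by rewrite big_nil hornerC normc1.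
rewrite big_cons hornerM hornerXsubC normcM exprS ler_pM ?exprn_ge0//.
  by apply: hs; rewrite mem_head.
by apply: IH => y ys; apply: hs; rewrite inE ys orbT.
Qed.

(** Only finitely many roots differ from 1, so the largest of their moduli is still below 1. *)
Lemma lt1_uniform_bound (s : seq C) : 
  (forall z, z \in s -> z = 1 \/ normc z < 1) ->
  exists2 r : R, 0 <= r < 1 & forall z, z \in s -> z = 1 \/ normc z <= r.
Proof.
elim: s => [|z s IH] hs; first by exists 0; rewrite ?lexx ?ltr01.
have [|r /andP[r0 r1] hr] := IH; first by move=> y ys; apply: hs; rewrite inE ys orbT.
have [->|z1] := hs z (mem_head _ _).
  exists r; rewrite ?r0// => y; rewrite inE => /predU1P[->|/hr//]; by left.
exists (Num.max r (normc z)); first by rewrite le_max r0 gt_max r1.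
move=> y; rewrite inE => /predU1P[->|/hr[->|yr]]; [right|by left|right].
  by rewrite le_max lexx orbT.
by rewrite le_max yr.
Qed.

End RootSeparation.

(** * Norm bounds in a form that composes *)

Section Bounds.
Variable R : realType.
Local Notation C := R[i].

Lemma mxl1D_le m n (X Y : 'M[C]_(m, n)) a b :
  mxl1 X <= a -> mxl1 Y <= b -> mxl1 (X + Y) <= a + b.
Proof. by move=> ha hb; exact: le_trans (mxl1D _ _) (lerD ha hb). Qed.

Lemma mxl1B_le m n (X Y : 'M[C]_(m, n)) a b :
  mxl1 X <= a -> mxl1 Y <= b -> mxl1 (X - Y) <= a + b.
Proof. by move=> ha hb; exact: le_trans (mxl1B _ _) (lerD ha hb). Qed.

Lemma mxl1M_le m n q (X : 'M[C]_(m, n)) (Y : 'M[C]_(n, q)) a b :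
  mxl1 X <= a -> mxl1 Y <= b -> mxl1 (X *m Y) <= a * b.
Proof. by move=> ha hb; apply: le_trans (mxl1M _ _) (ler_pM _ _ ha hb); exact: mxl1_ge0. Qed.

Lemma mxl1Z_le m n (X : 'M[C]_(m, n)) (c : C) a b :
  normc c <= a -> mxl1 X <= b -> mxl1 (c *: X) <= a * b.
Proof.
move=> ha hb; rewrite mxl1Z; apply: ler_pM => //; [exact: normc_ge0|exact: mxl1_ge0].
Qed.

Lemma mxl1_sum_le m n q (F : 'I_q -> 'M[C]_(m, n)) a :
  (forall i, mxl1 (F i) <= a) -> mxl1 (\sum_i F i) <= q%:R * a.
Proof.
move=> ha; apply: le_trans (mxl1_sum _ _ _) _.
apply: (@le_trans _ _ (\sum_(i < q) a)); first exact: ler_sum.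
by rewrite sumr_const card_ord mulr_natl.
Qed.

Lemma mx11_scale1 (X : 'M[C]_1) : X = X 0 0 *: 1%:M.
Proof. by rewrite scalemx1; exact: mx11_scalar. Qed.

Lemma ler_coord_norm m n (x : 'M[R]_(m, n)) i j : `|x i j| <= `|x|.
Proof.
rewrite [leRHS]/Num.norm/= mx_normrE.
exact: (@le_bigmax _ _ _ _ (fun ij => `|x ij.1 ij.2|) (i, j)).
Qed.

Lemma ler_norm_coord m n (x : 'M[R]_(m, n)) a :
  0 <= a -> (forall i j, `|x i j| <= a) -> `|x| <= a.
Proof.
move=> a0 ha; rewrite [leLHS]/Num.norm/= mx_normrE.
by apply: bigmax_le => // -[i j] _; exact: ha.
Qed.

Lemma normc_coord d (t : 'rV[R]_d) k : normc (t 0 k)%:C%C <= `|t|.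
Proof.
by rewrite normc_real; exact: ler_coord_norm.
Qed.

End Bounds.

(** * The fundamental matrix and normalized eigenvectors near the eigenvalue 1 *)

Section Perturbation.
Variables (R : realType) (d p : nat).
Local Notation C := R[i].
Local Notation V := 'rV[R]_d.
Variables (B : V -> 'M[C]_p) (dB : 'I_d -> V -> 'M[C]_p).
Variables (pi : 'rV[C]_p) (K : R).

Local Notation e := (const_mx 1 : 'cV[C]_p).
(** The differential of [B] at t applied to h, assembled from the partial derivatives [dB]. *)
Definition dirB (t h : V) : 'M[C]_p := \sum_(l < d) (h 0 l)%:C%C *: dB l t.

Hypothesis K0 : 0 <= K.
Hypothesis B_taylor : forall t h, mxl1 (B (t + h) - B t - dirB t h) <= K * `|h| ^+ 2.
Hypothesis dB_bound : forall l t, mxl1 (dB l t) <= K.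
Hypothesis Be : B 0 *m e = e.
Hypothesis piB : pi *m B 0 = pi.
Hypothesis pie : pi *m e = 1%:M.
Hypothesis B_peripheral : forall (v : 'cV[C]_p) z, B 0 *m v = z *: v -> v != 0 ->
  1 <= normc z -> z = 1 /\ exists a, v = const_mx a.

Let KL : R := (d%:R + 2) * K.

Lemma dirB_bound t h : mxl1 (dirB t h) <= d%:R * K * `|h|.
Proof.
rewrite -mulrA; apply: mxl1_sum_le => l; rewrite mulrC.
by apply: mxl1Z_le => //; exact: normc_coord.
Qed.

Lemma KL_ge0 : 0 <= KL.
Proof. by rewrite mulr_ge0// addr_ge0. Qed.

(** The differential contributes d K, and the quadratic remainder contributes 2 K because two points
    of the unit ball are at distance at most 2; hence the value of [KL]. *)
Lemma B_lipschitz s t : `|s| <= 1 -> `|t| <= 1 ->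
  mxl1 (B s - B t) <= KL * `|s - t|.
Proof.
move=> s1 t1; have h2 : `|s - t| <= 2.
  by apply: le_trans (ler_normB _ _) _; rewrite -[leRHS]/(1 + 1); exact: lerD.
have := B_taylor t (s - t); rewrite subrKC => hB.
have -> : B s - B t = B s - B t - dirB t (s - t) + dirB t (s - t) by rewrite subrK.
apply: le_trans (mxl1D_le hB (dirB_bound _ _)) _.
rewrite /KL; move: (`|s - t|) (normr_ge0 (s - t)) h2 => x x0 x2.
have : 0 <= K * (x * (2 - x)) by rewrite !mulr_ge0// subr_ge0.
nra.
Qed.

(** The inverse of [M0] is the fundamental matrix of the chain; it inverts 1 - [B 0] on the kernel
    of [pi] and fixes [e]. *)
Let M0 : 'M[C]_p := 1%:M - B 0 + e *m pi.

(** If M0 v = 0, multiplying by [pi] gives pi v = 0, so v is fixed by [B 0]. It is then constant,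
    and pi v = 0 makes it null. *)
Lemma M0_unit : M0 \in unitmx.
Proof.
rewrite -[_ \in _]negbK -[_ \notin _]/(~~ (M0 \in unitmx)).
apply/negP => nu.
have : eigenvalue M0 0.
  by rewrite eigenvalue_root_char rootE horner_char_poly raddf0 sub0r -scaleN1r detZ
    mulf_eq0 orbC -[_ == 0]negbK -unitfE -unitmxE nu.
move/eigenvalue_colP => [v]; rewrite scale0r /M0 => Mv v0.
have piv : pi *m v = 0.
  have := congr1 (mulmx pi) Mv.
  rewrite mulmx0 mulmxA mulmxDr mulmxBr mulmx1 piB subrr add0r.
  by rewrite mulmxA pie mul1mx.
move: Mv; rewrite mulmxDl mulmxBl mul1mx -mulmxA piv mulmx0 addr0 => /eqP.
rewrite subr_eq0 => /eqP /esym Bv.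
have [||_ [a va]] := @B_peripheral v 1 _ v0; rewrite ?scale1r ?normc1//.
have ve : v = a *: e by rewrite va; apply/matrixP => i j; rewrite !mxE mulr1.
have a0 : a = 0.
  move: piv; rewrite ve -scalemxAr pie => /matrixP /(_ 0 0).
  by rewrite !mxE mulr1.
by move: v0; rewrite ve a0 scale0r eqxx.
Qed.

Let S := invmx M0.

Lemma M0e : M0 *m e = e.
Proof. by rewrite mulmxDl mulmxBl mul1mx Be subrr add0r -mulmxA pie mulmx1. Qed.

Lemma piM0 : pi *m M0 = pi.
Proof. by rewrite mulmxDr mulmxBr mulmx1 piB subrr add0r mulmxA pie mul1mx. Qed.

(** Rewriting [B 0] v as z v - ([B t] - [B 0]) v inside M0 v leaves only small terms besides a
    multiple of [e]; applying [S] gives a fixed-point equation for v. *)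
Lemma right_eigen_eq z t (v : 'cV[C]_p) : B t *m v = z *: v ->
  v = (pi *m v) 0 0 *: e + S *m ((1 - z) *: v + (B t - B 0) *m v).
Proof.
move=> Bv; apply: (can_inj (mulKmx M0_unit)).
rewrite mulmxDr mulKVmx ?M0_unit// -scalemxAr M0e.
rewrite mulmxBl Bv scalerBl scale1r subrKA mulmxDl mulmxBl mul1mx addrC.
by rewrite -mulmxA {1}[pi *m v]mx11_scale1 -scalemxAr mulmx1.
Qed.

Lemma left_eigen_eq z t (l : 'rV[C]_p) : l *m B t = z *: l ->
  l = (l *m e) 0 0 *: pi + ((1 - z) *: l + l *m (B t - B 0)) *m S.
Proof.
move=> lB; apply: (can_inj (mulmxK M0_unit)).
rewrite mulmxDl mulmxKV ?M0_unit// -scalemxAl piM0.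
rewrite mulmxBr lB scalerBl scale1r subrKA mulmxDr mulmxBr mulmx1 addrC.
by rewrite mulmxA {1}[l *m e]mx11_scale1 -scalemxAl mul1mx.
Qed.

Let sS : R := mxl1 S.
Let se : R := mxl1 e.
Let sp : R := mxl1 pi.
(** The factors of [Q] are such that Q dev <= 1 forces each of the three products in
    [near_one_bounds] below 1/4. *)
Let Q : R := 4 * (1 + sS) * (1 + se) * (1 + sp).
Let dev z (t : V) : R := normc (1 - z) + KL * `|t|.

(* Where the fixed-point equations of the normalized eigenvectors are contractions. *)
Definition near_one z (t : V) : Prop := `|t| <= 1 /\ Q * dev z t <= 1.

Lemma sS_ge0 : 0 <= sS. Proof. exact: mxl1_ge0. Qed.
Lemma se_ge0 : 0 <= se. Proof. exact: mxl1_ge0. Qed.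
Lemma sp_ge0 : 0 <= sp. Proof. exact: mxl1_ge0. Qed.
Lemma dev_ge0 z t : 0 <= dev z t.
Proof. by rewrite addr_ge0 ?normc_ge0// mulr_ge0 ?KL_ge0. Qed.

Lemma Q_gt0 : 0 < Q.
Proof. by rewrite !mulr_gt0// ltr_pwDl ?sS_ge0 ?se_ge0 ?sp_ge0. Qed.

Lemma near_one_bounds z t : near_one z t ->
  [/\ sS * dev z t <= 4^-1, sS * dev z t * se <= 4^-1 & sS * dev z t * sp <= 4^-1].
Proof.
move=> [_]; rewrite /Q.
have := sS_ge0; have := se_ge0; have := sp_ge0; have := dev_ge0 z t.
move: (dev z t) => D D0 p0 e0 S0 h.
have SD : 0 <= sS * D by exact: mulr_ge0.
have h1 : (1 + se) * (1 + sp) * (sS * D) <= 4^-1.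
  apply: (@le_trans _ _ ((1 + sS) * (1 + se) * (1 + sp) * D)); last by lra.
  have -> : (1 + sS) * (1 + se) * (1 + sp) * D = (1 + se) * (1 + sp) * (sS * D) + (1 + se) * (1 + sp) * D by ring.
  by rewrite lerDl mulr_ge0// mulr_ge0// addr_ge0.
have ep : 0 <= se * sp by exact: mulr_ge0.
have a1 : 0 <= se * (sS * D) by exact: mulr_ge0.
have a2 : 0 <= sp * (sS * D) by exact: mulr_ge0.
have a3 : 0 <= se * sp * (sS * D) by exact: mulr_ge0.
split; nra.
Qed.

Lemma right_eigen_err z t (v : 'cV[C]_p) : `|t| <= 1 -> B t *m v = z *: v ->
  mxl1 (v - (pi *m v) 0 0 *: e) <= sS * dev z t * mxl1 v.
Proof.
move=> t1 Bv; rewrite {1}(right_eigen_eq Bv) addrC addKr.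
apply: le_trans (mxl1M_le (lexx _) (mxl1D_le (mxl1Z_le (lexx _) (lexx _)) (mxl1M_le (B_lipschitz t1 _) (lexx _)))) _.
  by rewrite normr0.
by rewrite subr0 -mulrDl mulrA.
Qed.

Lemma left_eigen_err z t (l : 'rV[C]_p) : `|t| <= 1 -> l *m B t = z *: l ->
  mxl1 (l - (l *m e) 0 0 *: pi) <= sS * dev z t * mxl1 l.
Proof.
move=> t1 lB; rewrite {1}(left_eigen_eq lB) addrC addKr.
apply: le_trans (mxl1M_le (mxl1D_le (mxl1Z_le (lexx _) (lexx _)) (mxl1M_le (lexx _) (B_lipschitz t1 _))) (lexx _)) _.
  by rewrite normr0.
by rewrite subr0 [mxl1 l * _]mulrC -mulrDl -/sS -/(dev z t) mulrC mulrA.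
Qed.

(** [right_dist] is the bound that tends to 0 at the origin; [right_half] and its left analogue keep
    l v away from 0. *)
Record right_normalized z t (v : 'cV[C]_p) : Prop := RightNormalized {
  right_eigen : B t *m v = z *: v;
  right_pi : pi *m v = 1%:M;
  right_bound : mxl1 v <= 2 * se;
  right_dist : mxl1 (v - e) <= 2 * se * sS * dev z t;
  right_half : mxl1 (v - e) <= 2^-1 }.

Record left_normalized z t (l : 'rV[C]_p) : Prop := LeftNormalized {
  left_eigen : l *m B t = z *: l;
  left_e : l *m e = 1%:M;
  left_bound : mxl1 l <= 2 * sp;
  left_dist : mxl1 (l - pi) <= 2 * sp * sS * dev z t;
  left_half : mxl1 (l - pi) <= 2^-1 }.

(** If pi v were 0, the error estimate would bound the norm of v by a quarter of itself. After
    division by pi v, the same contraction gives |w| <= |w| / 4 + |e|, hence |w| <= 2 |e|. *)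
Lemma right_normalize z t (v : 'cV[C]_p) : near_one z t -> B t *m v = z *: v ->
  v != 0 -> exists2 c, c != 0 & right_normalized z t (c *: v).
Proof.
move=> nz Bv v0; have [b1 b2 b3] := near_one_bounds nz.
have piv : (pi *m v) 0 0 != 0.
  apply/eqP => piv; have := right_eigen_err nz.1 Bv.
  rewrite piv scale0r subr0; apply/negP; rewrite -ltNge gtr_pMl ?mxl1_gt0//.
  by apply: le_lt_trans b1 _; lra.
exists ((pi *m v) 0 0)^-1; first by rewrite invr_eq0.
set c := _^-1; set w := c *: v.
have Bw : B t *m w = z *: w by rewrite -scalemxAr Bv !scalerA mulrC.
have piw : pi *m w = 1%:M.
  by rewrite -scalemxAr [pi *m v]mx11_scale1 scalerA mulVf ?scale1r.
have := right_eigen_err nz.1 Bw; rewrite piw mxE mulr1n scale1r => err.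
have wb : mxl1 w <= 2 * se.
  have : mxl1 w <= mxl1 (w - e) + se by rewrite -{1}(subrK e w) mxl1D.
  have := mxl1_ge0 w; have : 0 <= sS * dev z t by rewrite mulr_ge0 ?sS_ge0 ?dev_ge0.
  move: err b1; move: (sS * dev z t) (mxl1 w) (mxl1 (w - e)) => D a b h1 h2 h3 h4 h5.
  have : D * a <= 4^-1 * a by exact: ler_wpM2r.
  lra.
have wd : mxl1 (w - e) <= 2 * se * sS * dev z t.
  apply: le_trans err _; apply: le_trans (ler_wpM2l _ wb) _.
    by rewrite mulr_ge0 ?sS_ge0 ?dev_ge0.
  by rewrite le_eqVlt; apply/orP; left; apply/eqP; ring.
by split => //; apply: le_trans wd _; lra.
Qed.

Lemma left_normalize z t (l : 'rV[C]_p) : near_one z t -> l *m B t = z *: l ->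
  l != 0 -> exists2 c, c != 0 & left_normalized z t (c *: l).
Proof.
move=> nz lB l0; have [b1 b2 b3] := near_one_bounds nz.
have le_neq0 : (l *m e) 0 0 != 0.
  apply/eqP => le0; have := left_eigen_err nz.1 lB.
  rewrite le0 scale0r subr0; apply/negP; rewrite -ltNge gtr_pMl ?mxl1_gt0//.
  by apply: le_lt_trans b1 _; lra.
exists ((l *m e) 0 0)^-1; first by rewrite invr_eq0.
set c := _^-1; set w := c *: l.
have wB : w *m B t = z *: w by rewrite -scalemxAl lB !scalerA mulrC.
have we : w *m e = 1%:M.
  by rewrite -scalemxAl [l *m e]mx11_scale1 scalerA mulVf ?scale1r.
have := left_eigen_err nz.1 wB; rewrite we mxE mulr1n scale1r => err.
have wb : mxl1 w <= 2 * sp.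
  have : mxl1 w <= mxl1 (w - pi) + sp by rewrite -{1}(subrK pi w) mxl1D.
  have := mxl1_ge0 w; have : 0 <= sS * dev z t by rewrite mulr_ge0 ?sS_ge0 ?dev_ge0.
  move: err b1; move: (sS * dev z t) (mxl1 w) (mxl1 (w - pi)) => D a b h1 h2 h3 h4 h5.
  have : D * a <= 4^-1 * a by exact: ler_wpM2r.
  lra.
have wd : mxl1 (w - pi) <= 2 * sp * sS * dev z t.
  apply: le_trans err _; apply: le_trans (ler_wpM2l _ wb) _.
    by rewrite mulr_ge0 ?sS_ge0 ?dev_ge0.
  by rewrite le_eqVlt; apply/orP; left; apply/eqP; ring.
by split => //; apply: le_trans wd _; lra.
Qed.

(** The normalizations l e = 1, pi v = 1 and pi e = 1 cancel all terms of first order. The two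
    eigenvectors may belong to different eigenvalues and different points. *)
Lemma left_right_mul z t z' t' l v :
  left_normalized z t l -> right_normalized z' t' v ->
  l *m v = 1%:M + (l - pi) *m (v - e).
Proof.
move=> hl hv; rewrite mulmxBl !mulmxBr (left_e hl) (right_pi hv) pie.
by rewrite subrr subr0 addrC subrK.
Qed.

Lemma left_right_ge z t z' t' l v :
  left_normalized z t l -> right_normalized z' t' v ->
  2^-1 <= mxl1 (l *m v).
Proof.
move=> hl hv.
have h : (1%:M : 'M[C]_1) = l *m v - (l - pi) *m (v - e).
  by rewrite (left_right_mul hl hv) addrK.
have : mxl1 (1%:M : 'M[C]_1) <= mxl1 (l *m v) + 2^-1 * 2^-1.
  rewrite h; apply: mxl1B_le => //.
  exact: mxl1M_le (left_half hl) (right_half hv).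
by rewrite mxl111 mxE mulr1n normc1; lra.
Qed.

(** * Uniqueness, simplicity and existence of the eigenvalue near 1 *)

Lemma left_right_neq0 z t z' t' (l : 'rV[C]_p) (v : 'cV[C]_p) :
  near_one z t -> near_one z' t' ->
  l *m B t = z *: l -> l != 0 -> B t' *m v = z' *: v -> v != 0 ->
  l *m v != 0.
Proof.
move=> n1 n2 lB l0 Bv v0.
have [c c0 hl] := left_normalize n1 lB l0; have [b b0 hv] := right_normalize n2 Bv v0.
have := left_right_ge hl hv; apply: contraTneq => lv0.
by rewrite -scalemxAl -scalemxAr lv0 !scaler0 mxl10 -ltNge invr_gt0.
Qed.

(** Take a left eigenvector l for z and a right one v for z'. Evaluating l B v in both ways gives (z
    - z') l v = 0, and l v is nonzero. *)
Lemma near_one_unique z z' t : near_one z t -> near_one z' t ->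
  eigenvalue (B t) z -> eigenvalue (B t) z' -> z = z'.
Proof.
move=> n1 n2 /eigenvalueP[l lB l0] /eigenvalue_colP[v Bv v0].
have lv := left_right_neq0 n1 n2 lB l0 Bv v0.
have : (z - z') *: (l *m v) = 0.
  by rewrite scalerBl scalemxAl -lB scalemxAr -Bv mulmxA subrr.
by move/eqP; rewrite scaler_eq0 (negPf lv) orbF subr_eq0 => /eqP.
Qed.

(** Deflate by v pi. A left eigenvector u of the deflated matrix for z satisfies u v = 0 after
    multiplication by v; it is then a left eigenvector of [B t] itself, for which u v cannot
    vanish. *)
Lemma near_one_simple z t : near_one z t -> eigenvalue (B t) z ->
  mup z (char_poly (B t)) = 1%N.
Proof.
move=> nz /eigenvalue_colP[v0 Bv0 v00].
have [c c0] := right_normalize nz Bv0 v00; move: (c *: v0) => v hv.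
apply: (@mup_char_poly_simple _ _ _ v pi); [exact: right_eigen hv|exact: right_pi hv|].
apply/negP => /eigenvalueP[u uB u0].
have uv : u *m v = 0.
  have := congr1 (fun X => X *m v) uB; rewrite mulmxBr mulmxBl -mulmxA (right_eigen hv).
  rewrite -scalemxAr -scalemxAl -!mulmxA (right_pi hv) mulmx1.
  by move/eqP; rewrite -subr_eq0 addrAC subrr sub0r oppr_eq0 => /eqP.
have uB' : u *m B t = z *: u by rewrite -uB mulmxBr mulmxA uv mul0mx subr0.
have vn0 : v != 0.
  apply/eqP => v_eq0; have := right_pi hv; rewrite v_eq0 mulmx0 => /matrixP /(_ 0 0).
  by rewrite !mxE => /eqP; rewrite eq_sym oner_eq0.
by have := left_right_neq0 nz nz uB' u0 (right_eigen hv) vn0; rewrite uv eqxx.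
Qed.

Lemma B_lip0 i j : lip0 (fun t => B t i j).
Proof.
exists KL => [|t t1]; first exact: KL_ge0.
have -> : B t i j - B 0 i j = (B t - B 0) i j by rewrite !mxE.
apply: le_trans (mxl1_entry _ _ _) _.
by have := B_lipschitz t1 (_ : `|0| <= 1); rewrite subr0; apply; rewrite normr0.
Qed.

Lemma eigenvalue_B0_1 : eigenvalue (B 0) 1.
Proof.
apply/eigenvalue_colP; exists e; first by rewrite Be scale1r.
apply/eqP => e0; have := pie; rewrite e0 mulmx0 => /matrixP /(_ 0 0).
by rewrite !mxE => /eqP; rewrite eq_sym oner_eq0.
Qed.

Lemma near_one_10 : near_one 1 0.
Proof. by split; rewrite ?normr0// /dev subrr normc0 normr0 mulr0 addr0 mulr0. Qed.

Lemma B_gap : exists2 a : R, 0 <= a < 1 &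
  forall e1 : R, 0 < e1 -> e1 <= (1 - a) / 2 ->
  exists2 r : R, 0 < r & forall t : V, `|t| <= r ->
    (exists2 z, eigenvalue (B t) z & normc (1 - z) <= e1) /\
    (forall z, eigenvalue (B t) z -> (1 + a) / 2 <= normc z -> normc (1 - z) <= e1).
Proof.
have [s [szs hs es]] := char_poly_roots (B 0).
have [|a a01 ha] := @lt1_uniform_bound _ s.
  move=> z; rewrite es => /eigenvalue_colP[v Bv v0].
  have [|z1] := ltP (normc z) 1; first by right.
  by left; have [] := B_peripheral Bv v0 z1.
exists a => // e1 e10 e1a.
have [K1 K10 hdet] := lip0_det B_lip0 1.
have det0 : \det (1%:M - B 0) = 0.
  by apply/eqP; rewrite -horner_char_poly -rootE -eigenvalue_root_char eigenvalue_B0_1.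
have /choice [K2 hK2] : forall ij : 'I_p * 'I_p, exists K2 : R, 0 <= K2 /\ forall t : V, `|t| <= 1 ->
   normc (mxprod_sub s (B t) ij.1 ij.2 - mxprod_sub s (B 0) ij.1 ij.2) <= K2 * `|t|.
  by move=> ij; have [K2 K20 h] := lip0_mxprod_sub B_lip0 s ij.1 ij.2; exists K2.
pose G := \sum_ij K2 ij.
have G0 : 0 <= G by rewrite sumr_ge0// => ij _; have [] := hK2 ij.
have hG t : `|t| <= 1 -> mxl1 (mxprod_sub s (B t)) <= (p * p)%:R * (G * `|t|).
  move=> t1; apply: mxl1_le => i j; have [_ /(_ t t1) /=] := hK2 (i, j).
  rewrite (mxprod_sub_char_poly hs) mxE subr0 => /le_trans; apply.
  rewrite ler_wpM2r// /G (bigD1 (i, j))//= lerDl sumr_ge0// => ij _.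
  by have [] := hK2 ij.
(* [H] dominates the constants of both arguments below, and the summand 1 makes it positive. *)
pose H := 1 + K1 + (p * p)%:R * G.
have H0 : 0 < H by rewrite ltr_wpDr ?mulr_ge0// ltr_pwDl.
have ep : 0 < e1 ^+ p by rewrite exprn_gt0.
pose r := Num.min 1 (e1 ^+ p / (2 * H)).
have r0 : 0 < r by rewrite lt_min ltr01 divr_gt0// mulr_gt0.
exists r => // t tr.
have t1 : `|t| <= 1 by apply: le_trans tr _; rewrite ge_min lexx.
have Ht : H * `|t| < e1 ^+ p.
  apply: (@le_lt_trans _ _ (H * (e1 ^+ p / (2 * H)))).
    by rewrite ler_pM2l//; apply: le_trans tr _; rewrite ge_min lexx orbT.
  have -> : H * (e1 ^+ p / (2 * H)) = e1 ^+ p / 2 by field; rewrite gt_eqF.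
  by rewrite ltr_pdivrMr// ltr_pMr// ltr1n.
split.
  (* Existence: were all p eigenvalues farther than e1 from 1, the determinant of 1 - [B t] would
     have modulus at least e1^p. *)
  have [s' [szs' hs' es']] := char_poly_roots (B t).
  apply: contrapT => nex.
  have : e1 ^+ size s' <= normc (char_poly (B t)).[1].
    rewrite hs'; apply: normc_prod_XsubC_ge; first exact: ltW.
    move=> z zs; rewrite leNgt; apply/negP => hz; apply: nex; exists z; last exact: ltW.
    by rewrite -es'.
  rewrite szs'; apply/negP; rewrite -ltNge; apply: le_lt_trans Ht.
  rewrite horner_char_poly -[\det (1%:M - B t)]subr0 -[X in _ - X]det0.
  apply: le_trans (hdet t t1) _; rewrite ler_wpM2r// /H.
  by rewrite -addrA addrCA lerDl addr_ge0// mulr_ge0.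
(* Confinement: if z were far from 1 it would be far from the whole spectrum of [B 0], yet the
   Cayley-Hamilton product at [B t] scales u by the product of the distances and has norm O(|t|). *)
move=> z /eigenvalueP[u uB u0] za; rewrite leNgt; apply/negP => hz.
have : e1 ^+ size s <= normc (\prod_(y <- s) ('X - y%:P)).[z].
  apply: normc_prod_XsubC_ge; first exact: ltW.
  move=> y ys; have [->|ya] := ha y ys; first by rewrite normc_distC ltW.
  have : normc z <= normc (z - y) + normc y by rewrite -{1}(subrK y z) le_normcD.
  by lra.
rewrite szs; apply/negP; rewrite -ltNge; apply: le_lt_trans Ht.
have : normc (\prod_(y <- s) ('X - y%:P)).[z] * mxl1 u <= mxl1 u * ((p * p)%:R * (G * `|t|)).
  by rewrite -mxl1Z -(eigen_mxprod_sub s uB); apply: mxl1M_le => //; exact: hG.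
rewrite mulrC ler_pM2l ?mxl1_gt0// => /le_trans; apply.
by rewrite mulrA ler_wpM2r// /H lerDr addr_ge0.
Qed.

(** Any eigenvalue at least as large in modulus as the one found near 1 is itself near 1 by [B_gap],
    hence equal to it by uniqueness. *)
Lemma leading_eigenvalue_near0 : exists2 r : R, 0 < r & forall t : V, `|t| <= r ->
  (exists z, leading_eigenvalue (B t) z) /\
  (forall z, leading_eigenvalue (B t) z -> near_one z t).
Proof.
have [a /andP[a0 a1] gap] := B_gap.
(* Half of the allowance 1 / [Q] on [dev] goes to |1 - z|, the other half to the term in |t|. *)
pose e0 := (2 * Q)^-1.
have e00 : 0 < e0 by rewrite invr_gt0 mulr_gt0// Q_gt0.
pose e1 := Num.min e0 ((1 - a) / 2).
have e10 : 0 < e1 by rewrite lt_min e00 divr_gt0// subr_gt0.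
have e1e0 : e1 <= e0 by rewrite ge_min lexx.
have e1a : e1 <= (1 - a) / 2 by rewrite ge_min lexx orbT.
have [r r0 hr] := gap e1 e10 e1a.
have KL1 : 0 < KL + 1 by rewrite ltr_wpDl// KL_ge0.
pose r' := Num.min r (Num.min 1 (e0 / (KL + 1))).
exists r'; first by rewrite !lt_min r0 ltr01 divr_gt0.
move=> t; rewrite !le_min => /and3P[tr t1 te].
have KLt : KL * `|t| <= e0.
  apply: (@le_trans _ _ ((KL + 1) * `|t|)); first by rewrite ler_wpM2r// lerDl.
  by rewrite mulrC -ler_pdivlMr.
have near z : normc (1 - z) <= e1 -> near_one z t.
  move=> hz; split => //.
  have -> : 1 = Q * (e0 + e0) by rewrite /e0; field; rewrite gt_eqF ?Q_gt0.
  by rewrite ler_pM2l ?Q_gt0// /dev lerD// (le_trans hz).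
have [[z ez hz] others] := hr t tr.
have za : (1 + a) / 2 <= normc z.
  have : normc 1 <= normc (1 - z) + normc z by rewrite -{1}(subrK z 1) le_normcD.
  by rewrite normc1; lra.
split.
  exists z; split=> //; split; first exact: near_one_simple (near _ hz) ez.
  move=> z' ez' zz'; rewrite !normcE ltcR ltNge; apply: contra zz' => zle.
  have z'1 : normc (1 - z') <= e1 by apply: others => //; exact: (le_trans za zle).
  by apply/eqP; exact: (near_one_unique (near _ z'1) (near _ hz) ez' ez).
move=> z' [ez' [_ lz']]; apply: near; apply: others => //.
have [<-//|zz'] := eqVneq z z'.
have := lz' _ ez zz'; rewrite !normcE ltcR => /ltW; exact: le_trans za.
Qed.

(** * Lipschitz and first-order estimates for the eigenvalue *)

Variables (k : V -> C) (v : V -> 'cV[C]_p) (l : V -> 'rV[C]_p) (r : R).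
Hypothesis r_ge0 : 0 <= r.
Hypothesis k_near : forall t, `|t| <= r -> near_one (k t) t.
Hypothesis v_normalized : forall t, `|t| <= r -> right_normalized (k t) t (v t).
Hypothesis l_normalized : forall t, `|t| <= r -> left_normalized (k t) t (l t).

Lemma norm0_le_r : `|0 : V| <= r. Proof. by rewrite normr0. Qed.

Lemma k_at0 : k 0 = 1.
Proof.
apply: near_one_unique (k_near norm0_le_r) near_one_10 _ eigenvalue_B0_1.
apply/eigenvalue_colP; exists (v 0); first exact: right_eigen (v_normalized norm0_le_r).
apply/eqP => e0; have := right_pi (v_normalized norm0_le_r).
rewrite e0 mulmx0 => /matrixP /(_ 0 0).
by rewrite !mxE => /eqP; rewrite eq_sym oner_eq0.
Qed.

Lemma v_at0 : v 0 = e.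
Proof.
apply/eqP; rewrite -subr_eq0 -mxl1_eq0 eq_le mxl1_ge0 andbT.
apply: le_trans (right_dist (v_normalized norm0_le_r)) _.
by rewrite k_at0 /dev subrr normc0 normr0 mulr0 addr0 mulr0.
Qed.

(** Pairing a left eigenvector at t with a right eigenvector at s lets [B t] act on one side and
    [B s] on the other, so no regularity of the eigenvectors is required. *)
Lemma eigen_diff s t : `|s| <= r -> `|t| <= r ->
  (k s - k t) *: (l t *m v s) = l t *m (B s - B t) *m v s.
Proof.
move=> sr tr; rewrite mulmxBr mulmxBl -mulmxA (right_eigen (v_normalized sr)).
by rewrite (left_eigen (l_normalized tr)) -scalemxAr -scalemxAl scalerBl.
Qed.

Let Kk : R := 8 * sp * se * KL.

Lemma k_lipschitz s t : `|s| <= r -> `|t| <= r -> normc (k s - k t) <= Kk * `|s - t|.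
Proof.
move=> sr tr; have [s1 _] := k_near sr; have [t1 _] := k_near tr.
have h1 := left_right_ge (l_normalized tr) (v_normalized sr).
(* The constant 8 in [Kk] comes from the bounds 2 sp on l and 2 se on v, and from the lower bound
   1/2 on l v. *)
have h2 : normc (k s - k t) * mxl1 (l t *m v s) <= 2 * sp * (KL * `|s - t|) * (2 * se).
  rewrite -mxl1Z eigen_diff//; apply: mxl1M_le; last exact: right_bound (v_normalized sr).
  by apply: mxl1M_le; [exact: left_bound (l_normalized tr)|exact: B_lipschitz].
have h3 : normc (k s - k t) * 2^-1 <= normc (k s - k t) * mxl1 (l t *m v s).
  by rewrite ler_wpM2l// normc_ge0.
by move: (le_trans h3 h2); rewrite /Kk; lra.
Qed.

Lemma Kk_ge0 : 0 <= Kk.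
Proof. by rewrite !mulr_ge0 ?sp_ge0 ?se_ge0 ?KL_ge0. Qed.

Let Kv : R := 4 * sS * (Kk + KL) * se.

(** Subtract the fixed-point equations at s and t. The terms still containing v s - v t have a
    coefficient at most 1/4 and are absorbed on the left. *)
Lemma v_lipschitz s t : `|s| <= r -> `|t| <= r -> mxl1 (v s - v t) <= Kv * `|s - t|.
Proof.
move=> sr tr; have [s1 _] := k_near sr; have [t1 _] := k_near tr.
have [b1 _ _] := near_one_bounds (k_near tr).
have eqv u : `|u| <= r -> v u = e + S *m ((1 - k u) *: v u + (B u - B 0) *m v u).
  move=> ur; rewrite {1}(right_eigen_eq (right_eigen (v_normalized ur))).
  by rewrite (right_pi (v_normalized ur)) mxE mulr1n scale1r.
have h : v s - v t = S *m ((k t - k s) *: v s + (B s - B t) *m v s +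
     ((1 - k t) *: (v s - v t) + (B t - B 0) *m (v s - v t))).
  rewrite {1}(eqv _ sr) {1}(eqv _ tr) opprD addrACA subrr add0r -mulmxBr.
  congr (_ *m _); apply/matrixP => i j.
  rewrite !mulmxBl !mulmxBr !mxE; ring.
have : mxl1 (v s - v t) <= sS * ((Kk * `|s - t|) * (2 * se) + (KL * `|s - t|) * (2 * se) +
     (normc (1 - k t) * mxl1 (v s - v t) + (KL * `|t|) * mxl1 (v s - v t))).
  rewrite {1}h; apply: mxl1M_le => //; have vs := right_bound (v_normalized sr).
  apply: mxl1D_le; apply: mxl1D_le.
  - by apply: mxl1Z_le vs; rewrite normc_distC; exact: k_lipschitz.
  - by apply: mxl1M_le vs; exact: B_lipschitz.
  - exact: mxl1Z_le.
  - apply: mxl1M_le => //.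
    by have := B_lipschitz t1 (_ : `|0| <= 1); rewrite subr0; apply; rewrite normr0.
rewrite -(mulrDl (normc (1 - k t))) -/(dev (k t) t).
have := ler_wpM2r (mxl1_ge0 (v s - v t)) b1.
have : 0 <= sS * (Kk + KL) * se * `|s - t|.
  by rewrite !mulr_ge0 ?sS_ge0 ?se_ge0// addr_ge0 ?Kk_ge0 ?KL_ge0.
by rewrite /Kv; move: (dev _ _) (mxl1 (v s - v t)) => D x; lra.
Qed.

Lemma Kv_ge0 : 0 <= Kv.
Proof. by rewrite !mulr_ge0 ?sS_ge0 ?se_ge0// addr_ge0 ?Kk_ge0 ?KL_ge0. Qed.

Let Kl : R := 2 * sp * sS * (Kk + KL).

Lemma l_lipschitz0 t : `|t| <= r -> mxl1 (l t - pi) <= Kl * `|t|.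
Proof.
move=> tr; apply: le_trans (left_dist (l_normalized tr)) _.
rewrite /Kl -[leRHS]mulrA ler_wpM2l ?mulr_ge0 ?sp_ge0 ?sS_ge0// /dev mulrDl lerD2r.
by have := k_lipschitz tr norm0_le_r; rewrite k_at0 subr0 normc_distC.
Qed.

Lemma Kl_ge0 : 0 <= Kl.
Proof. by rewrite !mulr_ge0 ?sS_ge0 ?sp_ge0// addr_ge0 ?Kk_ge0 ?KL_ge0. Qed.

(** The classical first-order perturbation formula for the i-th partial derivative of [k]. *)
Definition dk (i : 'I_d) (t : V) : C := (l t *m dB i t *m v t) 0 0 / (l t *m v t) 0 0.

Lemma dkE i t : `|t| <= r -> dk i t *: (l t *m v t) = l t *m dB i t *m v t.
Proof.
move=> tr; rewrite [RHS]mx11_scale1 {1}[l t *m v t]mx11_scale1 scalerA mulfVK//.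
have := left_right_ge (l_normalized tr) (v_normalized tr); apply: contraTneq => lv0.
by rewrite mxl111 lv0 normc0 -ltNge invr_gt0.
Qed.

Lemma cancel_lv t (c : C) : `|t| <= r -> normc c <= 2 * mxl1 (c *: (l t *m v t)).
Proof.
move=> tr; have := left_right_ge (l_normalized tr) (v_normalized tr).
rewrite mxl1Z => h; have := ler_wpM2l (normc_ge0 c) h; lra.
Qed.

(** Multiply by l v and use [eigen_diff]. Replacing v s by v t costs products of two Lipschitz
    increments, hence quadratic errors. Uniformity in t gives differentiability on a whole ball, not
    at 0 alone. *)
Lemma k_taylor : exists2 K' : R, 0 <= K' & forall s t, `|s| <= r -> `|t| <= r ->
  normc (k s - k t - \sum_(i < d) ((s - t) 0 i)%:C%C * dk i t) <= K' * `|s - t| ^+ 2.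
Proof.
exists (2 * (2 * sp * K * (2 * se) + 2 * sp * KL * Kv + Kk * (2 * sp * Kv))).
  have [sp0 se0 KL0] := And3 sp_ge0 se_ge0 KL_ge0; have [Kv0 Kk0] := conj Kv_ge0 Kk_ge0.
  by rewrite !(mulr_ge0, addr_ge0, mxl1_ge0).
move=> s t sr tr; have [s1 _] := k_near sr; have [t1 _] := k_near tr.
apply: le_trans (cancel_lv _ tr) _; rewrite -[leRHS]mulrA ler_wpM2l//.
have -> : (k s - k t - \sum_(i < d) ((s - t) 0 i)%:C%C * dk i t) *: (l t *m v t) =
   l t *m (B s - B t - dirB t (s - t)) *m v t + l t *m (B s - B t) *m (v s - v t)
   - (k s - k t) *: (l t *m (v s - v t)).
  rewrite scalerBl scaler_suml.
  under eq_bigr do rewrite -scalerA dkE//.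
  have -> : \sum_(i < d) ((s - t) 0 i)%:C%C *: (l t *m dB i t *m v t) =
     l t *m dirB t (s - t) *m v t.
    rewrite /dirB mulmx_sumr mulmx_suml; apply: eq_bigr => i _.
    by rewrite -scalemxAr -scalemxAl.
  rewrite [l t *m (v s - v t)]mulmxBr scalerBr eigen_diff// !mulmxBr !mulmxBl.
  move: (l t *m B s *m v t) (l t *m B t *m v t) (l t *m B s *m v s) (l t *m B t *m v s).
  move: (l t *m dirB t (s - t) *m v t) ((k s - k t) *: (l t *m v t)) => x1 x2 x3 x4 x5 x6.
  by apply/matrixP => i j; rewrite !mxE; ring.
have ht : mxl1 (B s - B t - dirB t (s - t)) <= K * `|s - t| ^+ 2.
  by have := B_taylor t (s - t); rewrite subrKC.
have lt := left_bound (l_normalized tr); have vt := right_bound (v_normalized tr).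
have hv := v_lipschitz sr tr.
apply: le_trans (mxl1B_le (mxl1D_le (mxl1M_le (mxl1M_le lt ht) vt)
  (mxl1M_le (mxl1M_le lt (B_lipschitz s1 t1)) hv))
  (mxl1Z_le (k_lipschitz sr tr) (mxl1M_le lt hv))) _.
by rewrite le_eqVlt; apply/orP; left; apply/eqP; ring.
Qed.

(** * First-order expansion of the derivatives of the eigenvalue at 0 *)

Variables (m : 'I_d -> R) (ddB : 'I_d -> 'I_d -> 'M[C]_p) (sg : 'M[R]_d).
Hypothesis dB_taylor : forall i t,
  mxl1 (dB i t - dB i 0 - \sum_(j < d) (t 0 j)%:C%C *: ddB j i) <= K * `|t| ^+ 2.
Hypothesis dBe : forall i, dB i 0 *m e = ('i%C * (m i)%:C%C) *: e.
Hypothesis ddBe : forall i j, pi *m ddB i j *m e = (- (sg i j)%:C%C)%:M.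

(** By [dBe] the first-order change of [B] maps [e] to a multiple of [e], and the first-order change
    of [k] cancels it. The source term of the fixed-point equation for v - e is therefore
    quadratic. *)
Lemma v_second_order : exists2 K' : R, 0 <= K' & forall t, `|t| <= r ->
  mxl1 (v t - e) <= K' * `|t| ^+ 2.
Proof.
have [sS0 se0 sp0] := And3 sS_ge0 se_ge0 sp_ge0.
have [KL0 Kv0 Kk0] := And3 KL_ge0 Kv_ge0 Kk_ge0.
pose Km := sp * (K * se) + sp * KL * Kv.
exists (sS * (Km * se + K * se + (Kk * Kv + KL * Kv))).
  by rewrite /Km !(mulr_ge0, addr_ge0, mxl1_ge0).
move=> t tr; have [t1 _] := k_near tr.
have n01 : `|0 : V| <= 1 by rewrite normr0.
have vt : mxl1 (v t - e) <= Kv * `|t|.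
  by have := v_lipschitz tr norm0_le_r; rewrite v_at0 subr0.
have kt : normc (1 - k t) <= Kk * `|t|.
  by have := k_lipschitz tr norm0_le_r; rewrite k_at0 subr0 normc_distC.
have Bt : mxl1 (B t - B 0) <= KL * `|t|.
  by have := B_lipschitz t1 n01; rewrite subr0.
pose rm := B t - B 0 - dirB 0 t.
have rmt : mxl1 rm <= K * `|t| ^+ 2.
  by have := B_taylor 0 t; rewrite add0r.
(* [c] is the first-order part of k t - 1. *)
pose c := \sum_(i < d) (t 0 i)%:C%C * ('i%C * (m i)%:C%C).
have dirBe : dirB 0 t *m e = c *: e.
  rewrite /dirB mulmx_suml scaler_suml; apply: eq_bigr => i _.
  by rewrite -scalemxAl dBe scalerA.
have Bte : (B t - B 0) *m e = c *: e + rm *m e.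
  by rewrite -dirBe -mulmxDl subrKC.
have hk : mxl1 ((1 - k t + c) *: (1%:M : 'M[C]_1)) <= Km * `|t| ^+ 2.
  have -> : (1 - k t + c) *: (1%:M : 'M[C]_1) =
    - (pi *m (rm *m e)) - pi *m (B t - B 0) *m (v t - e).
    (* Apply [pi], which [B 0] fixes, to the eigenvector equation, with pi v = 1. *)
    have h1 : (k t - 1) *: 1%:M = pi *m (B t - B 0) *m v t.
      rewrite mulmxBr piB mulmxBl (right_pi (v_normalized tr)) -mulmxA.
      rewrite (right_eigen (v_normalized tr)) -scalemxAr (right_pi (v_normalized tr)).
      by rewrite scalerBl scale1r.
    have h2 : pi *m (B t - B 0) *m e = c *: 1%:M + pi *m (rm *m e).
      by rewrite -mulmxA Bte mulmxDr -scalemxAr pie.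
    rewrite mulmxBr -h1 h2; apply/matrixP => i j; rewrite !mxE; ring.
  apply: le_trans (mxl1B_le (_ : _ <= sp * (K * `|t| ^+ 2 * se))
     (mxl1M_le (mxl1M_le (lexx _) Bt) vt)) _.
    by rewrite mxl1N; apply: mxl1M_le => //; exact: mxl1M_le.
  by rewrite le_eqVlt; apply/orP; left; apply/eqP; rewrite -/sp /Km; ring.
have hk' : normc (1 - k t + c) <= Km * `|t| ^+ 2.
  by move: hk; rewrite mxl1Z mxl111 mxE mulr1n normc1 mulr1.
have -> : v t - e = S *m ((1 - k t + c) *: e + rm *m e +
    ((1 - k t) *: (v t - e) + (B t - B 0) *m (v t - e))).
  have -> : (1 - k t + c) *: e + rm *m e = (1 - k t) *: e + (B t - B 0) *m e.
    by rewrite Bte scalerDl addrA.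
  rewrite addrACA -scalerDr -mulmxDr subrKC.
  have := right_eigen_eq (right_eigen (v_normalized tr)).
  rewrite (right_pi (v_normalized tr)) mxE mulr1n scale1r => vE.
  by apply/eqP; rewrite subr_eq; apply/eqP; rewrite [RHS]addrC.
apply: le_trans (mxl1M_le (lexx _) (mxl1D_le (mxl1D_le (mxl1Z_le hk' (lexx _)) (mxl1M_le rmt (lexx _)))
  (mxl1D_le (mxl1Z_le kt vt) (mxl1M_le Bt vt)))) _.
by rewrite le_eqVlt; apply/orP; left; apply/eqP; rewrite -/sS -/se; ring.
Qed.

(** Multiply by l v = 1 + (l - pi)(v - e). The terms with v - e are quadratic by [v_second_order];
    (l - pi) D e is a product of two linear terms. What remains is pi dB(0) e + pi D e, that is i m
    minus the image of t under [sg]. *)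
Lemma dk_taylor i : exists2 K' : R, 0 <= K' & forall t, `|t| <= r ->
  normc (dk i t - (('i%C * (m i)%:C%C) - \sum_(j < d) (t 0 j * sg j i)%:C%C)) <= K' * `|t| ^+ 2.
Proof.
have [Ke Ke0 hve] := v_second_order.
have [sS0 se0 sp0] := And3 sS_ge0 se_ge0 sp_ge0.
have [KL0 Kv0 Kk0] := And3 KL_ge0 Kv_ge0 Kk_ge0.
have Kl0 := Kl_ge0.
pose G := \sum_(j < d) mxl1 (ddB j i).
have G0 : 0 <= G by rewrite sumr_ge0// => j _; exact: mxl1_ge0.
pose W := `|m i| + \sum_(j < d) `|sg j i|.
have W0 : 0 <= W by rewrite addr_ge0// sumr_ge0.
exists (2 * (2 * sp * K * Ke + Kl * (G * se) + 2 * sp * (K * se) + W * (2^-1 * Ke))).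
  by move: (W) (G) W0 G0 => W' G' W'0 G'0; rewrite !(mulr_ge0, addr_ge0, mxl1_ge0)// ?invr_ge0.
move=> t tr; have [t1 _] := k_near tr.
apply: le_trans (cancel_lv _ tr) _; rewrite -[leRHS]mulrA ler_wpM2l//.
pose c : C := ('i%C * (m i)%:C%C) - \sum_(j < d) (t 0 j * sg j i)%:C%C.
pose D := \sum_(j < d) (t 0 j)%:C%C *: ddB j i.
pose rm := dB i t - dB i 0 - D.
have hdBe : dB i t *m e = ('i%C * (m i)%:C%C) *: e + D *m e + rm *m e.
  by rewrite -dBe -!mulmxDl /rm; congr (_ *m _); rewrite -[_ - _ - D]addrA -opprD subrKC.
have hc : c *: 1%:M = ('i%C * (m i)%:C%C) *: 1%:M + pi *m D *m e.
  rewrite scalerBl; congr (_ + _).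
  rewrite /D mulmx_sumr mulmx_suml scaler_suml -sumrN; apply: eq_bigr => j _.
  rewrite -scalemxAr -scalemxAl ddBe !scale_scalar_mx mulr1 -raddfN mulrN.
  by rewrite rmorphM.
rewrite -/c.
have -> : (dk i t - c) *: (l t *m v t) =
    l t *m dB i t *m (v t - e) + (l t - pi) *m (D *m e) + l t *m (rm *m e)
    - c *: ((l t - pi) *m (v t - e)).
  rewrite scalerBl dkE// (left_right_mul (l_normalized tr) (v_normalized tr)) scalerDr hc.
  have h1 : l t *m dB i t *m e = ('i%C * (m i)%:C%C) *: 1%:M + l t *m (D *m e) + l t *m (rm *m e).
    by rewrite -mulmxA hdBe !mulmxDr -scalemxAr (left_e (l_normalized tr)).
  rewrite [l t *m dB i t *m (v t - e)]mulmxBr h1.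
  rewrite [(l t - pi) *m (D *m e)]mulmxBl [pi *m (D *m e)]mulmxA.
  by apply/matrixP => a b; rewrite !mxE; ring.
have Db : mxl1 D <= G * `|t|.
  apply: le_trans (mxl1_sum _ _ _) _; rewrite mulr_suml ler_sum// => j _.
  by rewrite mxl1Z mulrC ler_wpM2l ?mxl1_ge0// normc_coord.
have cb : normc c <= W.
  apply: le_trans (normcB _ _) _; rewrite normc_imag lerD2l.
  apply: le_trans (normc_sum _ _ _) _; apply: ler_sum => j _.
  rewrite normc_real normrM ler_piMl//; apply: le_trans t1; exact: ler_coord_norm.
have lt := left_bound (l_normalized tr); have lp := left_half (l_normalized tr).
apply: le_trans (mxl1B_le (mxl1D_le (mxl1D_le (mxl1M_le (mxl1M_le lt (dB_bound i t)) (hve _ tr))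
  (mxl1M_le (l_lipschitz0 tr) (mxl1M_le Db (lexx _)))) (mxl1M_le lt (mxl1M_le (dB_taylor i t) (lexx _))))
  (mxl1Z_le cb (mxl1M_le lp (hve _ tr)))) _.
by rewrite le_eqVlt; apply/orP; left; apply/eqP; rewrite -/se; field.
Qed.

End Perturbation.

(** * Absolutely summable real families *)

Section SumOverCountable.
Variables (R : realType) (T : choiceType).
Implicit Types (f g : T -> R).
Local Open Scope ereal_scope.
Local Notation esumT f := (\esum_(x in [set: T]) (f x)%:E).

Definition abs_summable f : Prop := \esum_(x in [set: T]) (`|f x|%R)%:E < +oo.

Lemma abs_summable_le f g : (forall x, `|f x| <= g x)%R -> abs_summable g -> abs_summable f.
Proof.
move=> fg; apply: le_lt_trans; apply: le_esum => x _; rewrite lee_fin.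
exact: le_trans (fg x) (ler_norm _).
Qed.

Lemma abs_summableD f g : abs_summable f -> abs_summable g ->
  abs_summable (fun x => f x + g x)%R.
Proof.
move=> sf sg; apply: (@le_lt_trans _ _ (\esum_(x in [set: T]) ((`|f x|%R)%:E + (`|g x|%R)%:E))).
  by apply: le_esum => x _; rewrite -EFinD lee_fin ler_normD.
by rewrite esumD ?lte_add_pinfty// => x _; rewrite lee_fin.
Qed.

Lemma esumZ (c : R) f : (0 < c)%R -> (forall x, 0 <= f x)%R ->
  esumT (fun x => c * f x)%R = c%:E * esumT f.
Proof.
move=> c0 f0; rewrite /esum -ereal_sup_pZl// image_comp; congr ereal_sup.
by apply: eq_imagel => A _ /=; rewrite ge0_mule_fsumr.
Qed.

Lemma abs_summableZ (c : R) f : abs_summable f -> abs_summable (fun x => c * f x)%R.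
Proof.
move=> sf; apply: (@abs_summable_le _ (fun x => (`|c| + 1) * `|f x|)%R).
  by move=> x; rewrite normrM ler_wpM2r// lerDl.
rewrite /abs_summable; under eq_esum do rewrite ger0_norm ?mulr_ge0// ?addr_ge0//.
by rewrite esumZ ?ltr_wpDl// lte_mul_pinfty ?lee_fin// addr_ge0.
Qed.

Lemma abs_summable_fin f : (forall x, 0 <= f x)%R -> abs_summable f -> esumT f \is a fin_num.
Proof.
move=> f0 sf; rewrite ge0_fin_numE; last by apply: esum_ge0 => x _; rewrite lee_fin.
by move: sf; rewrite /abs_summable; under eq_esum do rewrite ger0_norm//.
Qed.

Lemma fine_esumD f g : (forall x, 0 <= f x)%R -> (forall x, 0 <= g x)%R ->
  abs_summable f -> abs_summable g ->
  fine (esumT (fun x => f x + g x)%R) = (fine (esumT f) + fine (esumT g))%R.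
Proof.
move=> f0 g0 sf sg; rewrite -fineD ?abs_summable_fin//; congr fine.
by rewrite -esumD// => x _; rewrite lee_fin.
Qed.

(** The positive and negative parts of f - g satisfy P + g = N + f, an identity between nonnegative
    families, where sums add. Thus [rsum] may be computed from any decomposition into summable
    nonnegative families. *)
Lemma rsum_sub f g : (forall x, 0 <= f x)%R -> (forall x, 0 <= g x)%R ->
  abs_summable f -> abs_summable g ->
  rsum (fun x => f x - g x)%R = (fine (esumT f) - fine (esumT g))%R.
Proof.
move=> f0 g0 sf sg; rewrite /rsum.
set P := (fun x => Num.max (f x - g x) 0)%R; set N := (fun x => Num.max (- (f x - g x)) 0)%R.
have P0 x : (0 <= P x)%R by rewrite le_max lexx orbT.
have N0 x : (0 <= N x)%R by rewrite le_max lexx orbT.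
have sP : abs_summable P.
  apply: abs_summable_le sf => x; rewrite ger0_norm// /P ge_max f0 andbT.
  by rewrite gerBl.
have sN : abs_summable N.
  apply: abs_summable_le sg => x; rewrite ger0_norm// /N ge_max g0 andbT.
  by rewrite opprB gerBl.
have h : (fine (esumT P) + fine (esumT g) = fine (esumT N) + fine (esumT f))%R.
  rewrite -!fine_esumD//; congr fine; apply: eq_esum => x _; congr EFin.
  rewrite /P /N; case: (leP (f x - g x) 0)%R => fg; case: (leP (- (f x - g x)) 0)%R => fg'; lra.
rewrite -[X in (X - _)%R = _]/(fine (esumT P)) -[X in (_ - X)%R = _]/(fine (esumT N)).
lra.
Qed.

Lemma rsum_ge0E f : (forall x, 0 <= f x)%R -> abs_summable f -> rsum f = fine (esumT f).
Proof.
move=> f0 sf; have := @rsum_sub f (fun=> 0)%R f0 (fun=> lexx _) sf.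
under [X in rsum X]eq_fun do rewrite subr0.
move=> ->; first by rewrite [X in (_ - fine X)%R]esum1// subr0.
by rewrite /abs_summable esum1// => x _; rewrite normr0.
Qed.

Lemma abs_summable_max f : abs_summable f -> abs_summable (fun x => Num.max (f x) 0)%R.
Proof.
move=> sf; apply: (@abs_summable_le _ (fun x => `|f x|)%R).
  by move=> x; rewrite ger0_norm ?le_max ?lexx ?orbT// ge_max ler_norm normr_ge0.
by rewrite /abs_summable; under eq_esum do rewrite normr_id.
Qed.

Lemma abs_summableN f : abs_summable f -> abs_summable (fun x => - f x)%R.
Proof. by rewrite /abs_summable; under eq_esum do rewrite -normrN. Qed.

Lemma rsumD f g : abs_summable f -> abs_summable g ->
  rsum (fun x => f x + g x)%R = (rsum f + rsum g)%R.
Proof.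
move=> sf sg.
pose pos (h : T -> R) x := Num.max (h x) 0%R; pose opp (h : T -> R) x := (- h x)%R.
have pos0 h x : (0 <= pos h x)%R by rewrite le_max lexx orbT.
have -> : (fun x => f x + g x)%R =
    (fun x => (pos f x + pos g x) - (pos (opp f) x + pos (opp g) x))%R.
  apply/funext => x; have dec (a : R) : a = (Num.max a 0 - Num.max (- a) 0)%R.
    by case: (leP a 0)%R => fg; case: (leP (- a) 0)%R => fg'; lra.
  by rewrite {1}(dec (f x)) {1}(dec (g x)) /pos /opp; ring.
have sN h : abs_summable h -> abs_summable (pos (opp h)).
  by move=> sh; exact: abs_summable_max (abs_summableN sh).
have sP h : abs_summable h -> abs_summable (pos h) by exact: abs_summable_max.
rewrite rsum_sub; [|by move=> x; rewrite addr_ge0..|by apply: abs_summableD; [exact: sP|exact: sP]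
  |by apply: abs_summableD; [exact: sN|exact: sN]].
rewrite (fine_esumD (pos0 f) (pos0 g) (sP _ sf) (sP _ sg)).
rewrite (fine_esumD (pos0 (opp f)) (pos0 (opp g)) (sN _ sf) (sN _ sg)).
by rewrite opprD addrACA.
Qed.

Lemma rsumN f : rsum (fun x => - f x)%R = (- rsum f)%R.
Proof.
rewrite /rsum opprB; congr (fine _ - fine _)%R; apply: eq_esum => x _.
by rewrite opprK.
Qed.

Lemma rsumZ (c : R) f : abs_summable f -> rsum (fun x => c * f x)%R = (c * rsum f)%R.
Proof.
have pos (a : R) (h : T -> R) : (0 < a)%R -> rsum (fun x => a * h x)%R = (a * rsum h)%R.
  move=> a0; rewrite /rsum mulrBr.
  have hZ k : fine (esumT (fun x => Num.max (a * k x) 0)%R) =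
      (a * fine (esumT (fun x => Num.max (k x) 0)%R))%R.
    under eq_esum do rewrite -[X in Num.max _ X](mulr0 a) -maxr_pMr ?ltW//.
    rewrite esumZ//; last by move=> x; rewrite le_max lexx orbT.
    set E := \esum_(_ in _) _; have E0 : 0 <= E by apply: esum_ge0 => x _; rewrite lee_fin le_max lexx orbT.
    (* An infinite sum is sent to 0 by [fine] on both sides, so the scaling holds without
       summability. *)
    by move: E E0 => [e||]//= _; rewrite mulry gtr0_sg// mul1e /= mulr0.
  rewrite (hZ h) -(hZ (fun x => - h x)%R); congr (_ - fine _)%R; apply: eq_esum => x _.
  by rewrite mulrN.
move=> sf; have [c0|c0|->] := ltgtP c 0%R; last 2 first.
- exact: pos.
- under [X in rsum X]eq_fun do rewrite mul0r; rewrite mul0r rsum_ge0E//.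
    by rewrite esum1.
  by rewrite /abs_summable esum1// => x _; rewrite normr0.
have -> : (fun x => c * f x)%R = (fun x => - (- c * f x))%R.
  by apply/funext => x; rewrite mulNr opprK.
by rewrite rsumN pos ?oppr_gt0// mulNr opprK.
Qed.

Lemma ler_rsum f g : (forall x, f x <= g x)%R -> abs_summable f -> abs_summable g ->
  (rsum f <= rsum g)%R.
Proof.
move=> fg sf sg; rewrite -subr_ge0 -rsumN -rsumD//; last exact: abs_summableN.
rewrite rsum_ge0E.
- by apply: fine_ge0; apply: esum_ge0 => x _; rewrite lee_fin subr_ge0.
- by move=> x; rewrite subr_ge0.
- by apply: abs_summableD => //; exact: abs_summableN.
Qed.

Lemma ler_norm_rsum f g : (forall x, `|f x| <= g x)%R -> abs_summable g ->
  (`|rsum f| <= rsum g)%R.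
Proof.
move=> fg sg; have sf := abs_summable_le fg sg.
rewrite ler_norml -rsumN; apply/andP; split; apply: ler_rsum => //.
- by move=> x; rewrite lerNl (le_trans _ (fg x))// -normrN ler_norm.
- exact: abs_summableN.
- by move=> x; rewrite (le_trans (ler_norm _))//.
Qed.

Lemma rsum_gt0 f x : (forall x, 0 <= f x)%R -> abs_summable f -> (0 < f x)%R -> (0 < rsum f)%R.
Proof.
move=> f0 sf fx; rewrite rsum_ge0E// -lte_fin fineK ?abs_summable_fin//.
apply: (@lt_le_trans _ _ (f x)%:E); first by rewrite lte_fin.
by apply: esum_ge; exists [set x]%classic; [split|rewrite fsbig_set1].
Qed.

End SumOverCountable.

(** * Absolutely summable complex families *)

Section ComplexSum.
Variables (R : realType) (T : choiceType).
Local Notation C := R[i].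
Implicit Types f g : T -> C.

Definition csum f : C :=
  Complex (rsum (fun x => complex.Re (f x))) (rsum (fun x => complex.Im (f x))).

Definition cabs_summable f : Prop := abs_summable (fun x => normc (f x)).

Lemma cabs_summable_le f (g : T -> R) : (forall x, normc (f x) <= g x) ->
  abs_summable g -> cabs_summable f.
Proof.
by move=> fg; apply: abs_summable_le => x; rewrite ger0_norm ?normc_ge0.
Qed.

Lemma cabs_summable_Re f : cabs_summable f -> abs_summable (fun x => complex.Re (f x)).
Proof. by apply: abs_summable_le => x; exact: ler_Re_normc. Qed.

Lemma cabs_summable_Im f : cabs_summable f -> abs_summable (fun x => complex.Im (f x)).
Proof. by apply: abs_summable_le => x; exact: ler_Im_normc. Qed.

Lemma cabs_summableD f g : cabs_summable f -> cabs_summable g ->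
  cabs_summable (fun x => f x + g x).
Proof.
move=> sf sg; apply: cabs_summable_le (abs_summableD sf sg) => x; exact: le_normcD.
Qed.

Lemma cabs_summableZ c f : cabs_summable f -> cabs_summable (fun x => c * f x).
Proof.
move=> sf; apply: cabs_summable_le (abs_summableZ (normc c) sf) => x.
by rewrite normcM.
Qed.

Lemma csumD f g : cabs_summable f -> cabs_summable g ->
  csum (fun x => f x + g x) = csum f + csum g.
Proof.
move=> sf sg; rewrite /csum -[RHS]/(Complex (_ + _) (_ + _)); congr Complex.
  rewrite -(rsumD (cabs_summable_Re sf) (cabs_summable_Re sg)).
  by congr rsum; apply/funext => x; rewrite ReD.
rewrite -(rsumD (cabs_summable_Im sf) (cabs_summable_Im sg)).
by congr rsum; apply/funext => x; rewrite ImD.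
Qed.

Lemma csumZ c f : cabs_summable f -> csum (fun x => c * f x) = c * csum f.
Proof.
move=> sf; have sRe := cabs_summable_Re sf; have sIm := cabs_summable_Im sf.
case: c => a b; rewrite /csum -[RHS]/(Complex (_ * _ - _ * _) (_ * _ + _ * _)).
have sI := abs_summableN (abs_summableZ b sIm).
congr Complex; rewrite -(rsumZ _ sRe) -(rsumZ _ sIm).
  rewrite -rsumN -(rsumD (abs_summableZ a sRe) sI).
  by congr rsum; apply/funext => x; case: (f x).
rewrite -(rsumD (abs_summableZ a sIm) (abs_summableZ b sRe)).
by congr rsum; apply/funext => x; case: (f x).
Qed.

Lemma csum0 : csum (fun=> 0) = 0.
Proof.
have := @csumZ 0 (fun=> 0); under [X in csum X]eq_fun do rewrite mul0r.
by rewrite mul0r; apply; rewrite /cabs_summable /abs_summable esum1// => x _; rewrite normc0 normr0.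
Qed.

Lemma rsum0 : rsum (fun _ : T => 0 : R) = 0.
Proof. exact: (congr1 (@complex.Re R) csum0). Qed.

Lemma csum_sum (I : finType) (F : I -> T -> C) : (forall i, cabs_summable (F i)) ->
  csum (fun x => \sum_i F i x) = \sum_i csum (F i) /\
  cabs_summable (fun x => \sum_i F i x).
Proof.
move=> sF; elim: (index_enum I) => [|i s [IH1 IH2]].
  have -> : (fun x => \sum_(j <- [::]) F j x) = (fun=> 0).
    by apply/funext => x; rewrite big_nil.
  rewrite big_nil csum0; split => //.
  by rewrite /cabs_summable /abs_summable esum1// => x _; rewrite normc0 normr0.
have -> : (fun x => \sum_(j <- i :: s) F j x) = (fun x => F i x + \sum_(j <- s) F j x).
  by apply/funext => x; rewrite big_cons.
by rewrite csumD// big_cons IH1; split => //; exact: cabs_summableD.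
Qed.

(** The factor 2 comes from bounding real and imaginary parts separately. *)
Lemma normc_csum_le f (g : T -> R) : (forall x, normc (f x) <= g x) ->
  abs_summable g -> normc (csum f) <= 2 * rsum g.
Proof.
move=> fg sg; apply: le_trans (normc_le _) _; rewrite mulr2n mulrDl mul1r.
apply: lerD; apply: ler_norm_rsum => // x; apply: le_trans (fg x).
  exact: ler_Re_normc.
exact: ler_Im_normc.
Qed.

End ComplexSum.

(** * Second-order estimate for exp(i b) *)

Section Expi.
Variable R : realType.
Local Open Scope classical_set_scope.
Local Notation C := R[i].

Definition expi (a : R) : C := Complex (cos a) (sin a).

Lemma expiD a b : expi (a + b) = expi a * expi b.
Proof. by rewrite /expi cosD sinD; congr Complex; rewrite addrC mulrC [sin b * _]mulrC. Qed.

Lemma expi0 : expi 0 = 1.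
Proof. by rewrite /expi cos0 sin0. Qed.

Lemma mvt_bound (f df : R -> R) (M b : R) :
  (forall x : R, is_derive x 1 f (df x)) -> (forall x, `|x| <= `|b| -> `|df x| <= M) ->
  `|f b - f 0| <= M * `|b|.
Proof.
move=> fd dfM.
have cf a c : {within `[a, c], continuous f}.
  apply: derivable_within_continuous => x _; exact: ex_derive.
have [b0|b0] := leP 0 b.
  have [c cab ->] := MVT_segment b0 (fun x _ => fd x) (cf _ _).
  rewrite subr0 normrM ler_wpM2r// dfM//; move: cab; rewrite in_itv /= => /andP[c0 cb].
  by rewrite !ger0_norm.
have [c cab h] := MVT_segment (ltW b0) (fun x _ => fd x) (cf _ _).
rewrite distrC h sub0r normrM normrN ler_wpM2r// dfM//.
move: cab; rewrite in_itv /= => /andP[bc c0].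
by rewrite (ler0_norm c0) (ltr0_norm b0) lerN2.
Qed.

Lemma norm_sin_le (b : R) : `|sin b| <= `|b|.
Proof.
have := @mvt_bound sin cos 1 b (fun x => is_derive_sin x) (fun x _ => cos_max x).
by rewrite sin0 subr0 mul1r.
Qed.

Lemma norm_cos1_le (b : R) : `|cos b - 1| <= `|b| ^+ 2.
Proof.
have := @mvt_bound cos (fun x => - sin x) `|b| b (fun x => is_derive_cos x).
rewrite cos0 -expr2; apply => x xb; rewrite normrN; exact: le_trans (norm_sin_le x) xb.
Qed.

Lemma norm_sinB_le (b : R) : `|sin b - b| <= `|b| ^+ 2.
Proof.
have hd (x : R) : is_derive x 1 (@sin R - id) (cos x - 1) by exact: is_deriveB.
have := @mvt_bound _ _ `|b| b hd.
rewrite !fctE /= sin0 !subr0 -expr2; apply => x xb; apply: le_trans xb.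
have := @mvt_bound cos (fun x => - sin x) 1 x (fun x => is_derive_cos x).
by rewrite cos0 mul1r; apply => y _; rewrite normrN sin_max.
Qed.

Lemma expi_taylor (b : R) : normc (expi b - 1 - ('i%C * b%:C%C)) <= 2 * `|b| ^+ 2.
Proof.
apply: le_trans (normc_le _) _; rewrite mulr2n mulrDl mul1r; apply: lerD.
  by rewrite /= mul0r mulr0 subrr subr0 norm_cos1_le.
by rewrite /= mul0r mul1r subr0 add0r norm_sinB_le.
Qed.

End Expi.

(** * Taylor estimates for Fourier transforms of weighted point families *)

Section FourierTaylor.
Variables (R : realType) (T : choiceType) (d : nat).
Local Notation C := R[i].
Local Notation V := 'rV[R]_d.

Definition dotr (a t : V) : R := \sum_(k < d) a 0 k * t 0 k.

Lemma dotrDr a t h : dotr a (t + h) = dotr a t + dotr a h.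
Proof. by rewrite -big_split; apply: eq_bigr => k _; rewrite mxE mulrDr. Qed.

Lemma dotr0 a : dotr a 0 = 0.
Proof. by rewrite /dotr big1// => k _; rewrite mxE mulr0. Qed.

Variables (y : T -> V) (w n : T -> R).
Hypothesis w_ge0 : forall x, 0 <= w x.
Hypothesis n_ge1 : forall x, 1 <= n x.
Hypothesis y_le : forall x, \sum_(k < d) `|y x 0 k| <= n x.
Hypothesis n3_summable : abs_summable (fun x => n x ^+ 3 * w x).

Let Mo : R := rsum (fun x => n x ^+ 3 * w x).

Lemma Mo_ge0 : 0 <= Mo.
Proof.
rewrite /Mo rsum_ge0E//; last first.
  by move=> x; rewrite mulr_ge0// exprn_ge0// (le_trans _ (n_ge1 x)).
apply: fine_ge0; apply: esum_ge0 => x _; rewrite lee_fin.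
by rewrite mulr_ge0// exprn_ge0// (le_trans _ (n_ge1 x)).
Qed.

Lemma y_coord_le x k : `|y x 0 k| <= n x.
Proof. by apply: le_trans (y_le x); rewrite (bigD1 k)//= lerDl sumr_ge0. Qed.

Lemma dotr_le x t : `|dotr (y x) t| <= n x * `|t|.
Proof.
apply: le_trans (ler_norm_sum _ _ _) _.
apply: (@le_trans _ _ (\sum_(k < d) `|y x 0 k| * `|t|)).
  by apply: ler_sum => k _; rewrite normrM ler_wpM2l// ler_coord_norm.
by rewrite -mulr_suml ler_wpM2r.
Qed.

(** As n >= 1, any power up to the third is below n^3, so the single moment [Mo] controls all the
    sums. *)
Lemma csum_weight (f : T -> C) c j : (j <= 3)%N -> 0 <= c ->
  (forall x, normc (f x) <= c * n x ^+ j) ->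
  cabs_summable (fun x => f x * (w x)%:C%C) /\
  normc (csum (fun x => f x * (w x)%:C%C)) <= 2 * c * Mo.
Proof.
move=> j3 c0 fc.
have h x : normc (f x * (w x)%:C%C) <= c * (n x ^+ 3 * w x).
  rewrite normcM normc_real (ger0_norm (w_ge0 x)) mulrA ler_wpM2r//.
  by apply: le_trans (fc x) _; rewrite ler_wpM2l// ler_weXn2l.
have sg := abs_summableZ c n3_summable.
split; first exact: cabs_summable_le h sg.
by apply: le_trans (normc_csum_le h sg) _; rewrite rsumZ// mulrA.
Qed.

Definition fourier t : C := csum (fun x => expi (dotr (y x) t) * (w x)%:C%C).
Definition dfourier (l : 'I_d) t : C :=
  csum (fun x => ('i%C * (y x 0 l)%:C%C) * expi (dotr (y x) t) * (w x)%:C%C).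
Definition ddfourier (k l : 'I_d) : C :=
  csum (fun x => - (y x 0 k * y x 0 l)%:C%C * (w x)%:C%C).

Lemma fourier_summable t : cabs_summable (fun x => expi (dotr (y x) t) * (w x)%:C%C).
Proof.
apply: (@csum_weight (fun x => expi (dotr (y x) t)) 1 0%N _ _ _).1 => // x.
by rewrite normc_expi mul1r.
Qed.

Lemma dfourier_weight l t :
  cabs_summable (fun x => ('i%C * (y x 0 l)%:C%C) * expi (dotr (y x) t) * (w x)%:C%C) /\
  normc (dfourier l t) <= 2 * 1 * Mo.
Proof.
apply: (@csum_weight (fun x => ('i%C * (y x 0 l)%:C%C) * expi (dotr (y x) t)) 1 1%N) => // x.
by rewrite normcM normc_expi normc_imag mulr1 mul1r y_coord_le.
Qed.

Lemma ddfourier_summable k l :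
  cabs_summable (fun x => - (y x 0 k * y x 0 l)%:C%C * (w x)%:C%C).
Proof.
apply: (@csum_weight (fun x => - (y x 0 k * y x 0 l)%:C%C) 1 2%N _ _ _).1 => // x.
rewrite normcN normc_real normrM mul1r expr2.
by apply: ler_pM => //; exact: y_coord_le.
Qed.

(** Factoring out the unimodular exp(i y.t) reduces each term to the expansion of exp(i y.h) at 0,
    so the bound is uniform in t. *)
Lemma fourier_taylor t h :
  normc (fourier (t + h) - fourier t - \sum_(l < d) (h 0 l)%:C%C * dfourier l t)
    <= 4 * Mo * `|h| ^+ 2.
Proof.
pose rm x := expi (dotr (y x) t) * (expi (dotr (y x) h) - 1 - ('i%C * (dotr (y x) h)%:C%C)).
have [_ hm] : cabs_summable (fun x => rm x * (w x)%:C%C) /\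
    normc (csum (fun x => rm x * (w x)%:C%C)) <= 2 * (2 * `|h| ^+ 2) * Mo.
  apply: (@csum_weight rm _ 2%N) => // x; rewrite normcM normc_expi mul1r.
  apply: le_trans (expi_taylor _) _; rewrite -mulrA ler_wpM2l// mulrC -exprMn.
  by rewrite lerXn2r ?nnegrE ?mulr_ge0 ?dotr_le// (le_trans _ (n_ge1 x)).
pose f1 x := expi (dotr (y x) (t + h)) * (w x)%:C%C.
pose f2 x := expi (dotr (y x) t) * (w x)%:C%C.
pose f3 l x := ('i%C * (y x 0 l)%:C%C) * expi (dotr (y x) t) * (w x)%:C%C.
have [s1 s2] := @csum_sum _ _ _ (fun l x => - (h 0 l)%:C%C * f3 l x)
  (fun l => cabs_summableZ _ (dfourier_weight l t).1).
have s3 := cabs_summableZ (-1) (fourier_summable t).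
have -> : fourier (t + h) - fourier t - \sum_(l < d) (h 0 l)%:C%C * dfourier l t =
    csum (fun x => f1 x + (-1 * f2 x + \sum_(l < d) - (h 0 l)%:C%C * f3 l x)).
  rewrite (csumD (fourier_summable _) (cabs_summableD s3 s2)) (csumD s3 s2) s1.
  rewrite (csumZ _ (fourier_summable t)) mulN1r addrA -sumrN; congr (_ + _).
  by apply: eq_bigr => l _; rewrite (csumZ _ (dfourier_weight l t).1) mulNr.
have -> : (fun x => f1 x + (-1 * f2 x + \sum_(l < d) - (h 0 l)%:C%C * f3 l x)) =
    (fun x => rm x * (w x)%:C%C).
  apply/funext => x; rewrite /f1 /f2 dotrDr expiD /rm.
  have -> : \sum_(l < d) - (h 0 l)%:C%C * f3 l x =
     - (('i%C * (dotr (y x) h)%:C%C) * (expi (dotr (y x) t) * (w x)%:C%C)).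
    rewrite /dotr rmorph_sum/= mulr_sumr mulr_suml -sumrN; apply: eq_bigr => l _.
    by rewrite /f3 rmorphM /=; ring.
  by ring.
by apply: le_trans hm _; rewrite le_eqVlt; apply/orP; left; apply/eqP; ring.
Qed.

(** The third moment is used here: one power of n for the differentiated factor, two for the
    quadratic remainder. *)
Lemma dfourier_taylor l t :
  normc (dfourier l t - dfourier l 0 - \sum_(k < d) (t 0 k)%:C%C * ddfourier k l)
    <= 4 * Mo * `|t| ^+ 2.
Proof.
pose rm x := ('i%C * (y x 0 l)%:C%C) * (expi (dotr (y x) t) - 1 - ('i%C * (dotr (y x) t)%:C%C)).
have [_ hm] : cabs_summable (fun x => rm x * (w x)%:C%C) /\
    normc (csum (fun x => rm x * (w x)%:C%C)) <= 2 * (2 * `|t| ^+ 2) * Mo.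
  apply: (@csum_weight rm _ 3%N) => // x; rewrite normcM normc_imag.
  have -> : 2 * `|t| ^+ 2 * n x ^+ 3 = n x * (2 * (n x * `|t|) ^+ 2) by ring.
  apply: ler_pM; rewrite ?normc_ge0 ?y_coord_le//.
  apply: le_trans (expi_taylor _) _; rewrite ler_wpM2l//.
  by rewrite lerXn2r ?nnegrE ?mulr_ge0 ?dotr_le// (le_trans _ (n_ge1 x)).
pose f1 s x := ('i%C * (y x 0 l)%:C%C) * expi (dotr (y x) s) * (w x)%:C%C.
pose f3 k x := - (y x 0 k * y x 0 l)%:C%C * (w x)%:C%C.
have [s1 s2] := @csum_sum _ _ _ (fun k x => - (t 0 k)%:C%C * f3 k x)
  (fun k => cabs_summableZ _ (ddfourier_summable k l)).
have s3 := cabs_summableZ (-1) (dfourier_weight l 0).1.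
have -> : dfourier l t - dfourier l 0 - \sum_(k < d) (t 0 k)%:C%C * ddfourier k l =
    csum (fun x => f1 t x + (-1 * f1 0 x + \sum_(k < d) - (t 0 k)%:C%C * f3 k x)).
  rewrite (csumD (dfourier_weight l t).1 (cabs_summableD s3 s2)) (csumD s3 s2) s1.
  rewrite (csumZ _ (dfourier_weight l 0).1) mulN1r addrA -sumrN; congr (_ + _).
  by apply: eq_bigr => k _; rewrite (csumZ _ (ddfourier_summable k l)) mulNr.
have -> : (fun x => f1 t x + (-1 * f1 0 x + \sum_(k < d) - (t 0 k)%:C%C * f3 k x)) =
    (fun x => rm x * (w x)%:C%C).
  apply/funext => x; rewrite /f1 dotr0 expi0 /rm.
  have -> : \sum_(k < d) - (t 0 k)%:C%C * f3 k x =
     (dotr (y x) t)%:C%C * ((y x 0 l)%:C%C * (w x)%:C%C).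
    rewrite /dotr rmorph_sum/= mulr_suml; apply: eq_bigr => k _.
    by rewrite /f3 !rmorphM /=; ring.
  have ii : 'i%C * 'i%C = -1 :> C by rewrite -expr2 sqr_i.
  move: (expi _) ((y x 0 l)%:C)%C ((w x)%:C)%C ((dotr _ _)%:C)%C => a b c e.
  (* [ring] treats ['i%C] as a variable, so its square is isolated before being replaced by -1. *)
  transitivity ('i%C * b * (a - 1) * c - ('i%C * 'i%C) * (e * (b * c))); last by ring.
  by rewrite ii; ring.
by apply: le_trans hm _; rewrite le_eqVlt; apply/orP; left; apply/eqP; ring.
Qed.

Lemma dfourier_bound l t : normc (dfourier l t) <= 4 * Mo.
Proof.
apply: le_trans (dfourier_weight l t).2 _; rewrite mulr1 ler_wpM2r ?Mo_ge0//.
by rewrite ler_nat.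
Qed.

Lemma fourier0 : fourier 0 = (rsum w)%:C%C.
Proof.
rewrite /fourier /csum; congr Complex.
  by congr rsum; apply/funext => x; rewrite dotr0 expi0 mul1r.
have -> : (fun x => complex.Im (expi (dotr (y x) 0) * (w x)%:C%C)) = (fun=> 0).
  by apply/funext => x; rewrite dotr0 expi0 mul1r.
exact: rsum0.
Qed.

Lemma dfourier0 l : dfourier l 0 = ('i%C * (rsum (fun x => y x 0 l * w x))%:C%C).
Proof.
rewrite /dfourier /csum -[RHS]/(Complex (0 * _ - 1 * 0) (0 * 0 + 1 * _)).
rewrite !mul0r !mul1r subr0 add0r; congr Complex.
  rewrite -[RHS](rsum0 R T); congr rsum; apply/funext => x; rewrite dotr0 expi0 mulr1 /=; ring.
congr rsum; apply/funext => x; rewrite dotr0 expi0 mulr1 /=; ring.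
Qed.

Lemma ddfourierE k l : ddfourier k l = - (rsum (fun x => y x 0 k * y x 0 l * w x))%:C%C.
Proof.
rewrite /ddfourier /csum -[RHS]/(Complex (- _) (- 0)) oppr0 -rsumN; congr Complex.
  congr rsum; apply/funext => x /=; ring.
rewrite -[RHS](rsum0 R T); congr rsum; apply/funext => x /=; ring.
Qed.

End FourierTaylor.

(** * Differentiability from a quadratic remainder *)

Section DifferentialFromBound.
Variables (R : realType) (V W : normedModType R).

Lemma quadratic_is_diff (f : V -> W) (x : V) (L : {linear V -> W}) (c K r : R) :
  0 < r -> (forall h, `|L h| <= c * `|h|) ->
  (forall h, `|h| <= r -> `|f (x + h) - f x - L h| <= K * `|h| ^+ 2) ->
  differentiable f x /\ 'd f x = L :> (V -> W).
Proof.
move=> r0 Lc fL.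
have cL : continuous L.
  apply/linear_bounded_continuous/linear_boundedP; exists c; split; first exact: num_real.
  move=> c' cc' h; apply: le_trans (Lc h) _; rewrite ler_wpM2r//; exact: ltW.
have fo : f \o shift x = cst (f x) + L +o_ 0 id.
  apply/eqaddoP => e e0.
  (* [K] has no assumed sign; |K| + 1 is a positive substitute by which one may divide. *)
  have K1 : 0 < `|K| + 1 by rewrite ltr_wpDl.
  near=> h.
  have hr : `|h| <= r by near: h; apply: nbhs0_le.
  have he : `|h| <= e / (`|K| + 1) by near: h; apply: nbhs0_le; rewrite divr_gt0.
  rewrite [X in `|X|](_ : _ = f (x + h) - f x - L h); last first.
    by rewrite !fctE /= [h + x]addrC opprD addrA.
  apply: le_trans (fL h hr) _; rewrite expr2 mulrA ler_wpM2r//.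
  apply: (@le_trans _ _ ((`|K| + 1) * `|h|)).
    by rewrite ler_wpM2r// (le_trans (ler_norm K))// lerDl.
  by rewrite mulrC -ler_pdivlMr.
have dfL := diff_unique cL fo.
by split => //; apply/diff_locallyP; rewrite dfL.
Unshelve. all: by end_near. Qed.

End DifferentialFromBound.

(** * Gradient and Hessian from explicit remainder bounds *)

Section SecondOrder.
Variables (R : realType) (d : nat).
Local Notation V := 'rV[R]_d.

Definition lform (a : 'I_d -> R) (h : V) : R := \sum_(i < d) h 0 i * a i.

Lemma lform_is_linear a : linear_for *:%R (lform a : V -> R^o).
Proof.
move=> c u v; rewrite /lform scaler_sumr -big_split; apply: eq_bigr => i _.
by rewrite !mxE mulrDl -mulrA.
Qed.

HB.instance Definition _ a :=
  GRing.isLinear.Build R V R^o *:%R (lform a) (lform_is_linear a).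

Lemma lform_bound a h : `|lform a h| <= (\sum_(i < d) `|a i|) * `|h|.
Proof.
apply: le_trans (ler_norm_sum _ _ _) _; rewrite mulr_suml ler_sum// => i _.
by rewrite normrM mulrC ler_wpM2l// ler_coord_norm.
Qed.

(** The two-point bound identifies the gradient with [a] at every point of the open ball; the second
    bound then differentiates this gradient at 0. *)
Lemma twice_differentiable_bounds (f : V -> R) (a : 'I_d -> V -> R) (a0 : V)
    (H : 'M[R]_d) (r K1 K2 : R) :
  0 < r -> 0 <= K2 ->
  (forall s t, `|s| <= r -> `|t| <= r ->
    `|f s - f t - \sum_(i < d) (s - t) 0 i * a i t| <= K1 * `|s - t| ^+ 2) ->
  (forall i t, `|t| <= r ->
    `|a i t - (a0 0 i + \sum_(j < d) t 0 j * H j i)| <= K2 * `|t| ^+ 2) ->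
  [/\ twice_differentiable f 0, grad f 0 = a0 & hessian f 0 = H].
Proof.
move=> r0 K20 hf ha.
have df t : `|t| < r -> differentiable f t /\ 'd f t = lform (a ^~ t) :> (V -> R).
  (* The radius r - |t| keeps t + h in the ball where the two-point bound holds. *)
  move=> tr; have rt0 : 0 < r - `|t| by rewrite subr_gt0.
  apply: (quadratic_is_diff (L := lform (a ^~ t)) rt0 (lform_bound _)) => h hr.
  have := hf (t + h) t; rewrite [t + h - t]addrC addKr; apply; last exact: ltW.
  by apply: le_trans (ler_normD _ _) _; rewrite -lerBrDl.
have gradE t : `|t| < r -> grad f t = \row_i a i t.
  move=> tr; apply/rowP => i; rewrite !mxE (df t tr).2 /lform (bigD1 i)//= big1.
    by rewrite mxE !eqxx mul1r addr0.
  by move=> j ji; rewrite mxE eqxx (negPf ji) mul0r.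
have n0 : `|0 : V| < r by rewrite normr0.
have a0E i : a i 0 = a0 0 i.
  have := ha i 0 (ltW n0); rewrite normr0 expr0n mulr0 big1 => [|j _]; last by rewrite mxE mul0r.
  by rewrite addr0 normr_le0 subr_eq0 => /eqP.
have grad0 : grad f 0 = a0 by rewrite gradE//; apply/rowP => i; rewrite mxE a0E.
(* Acting on row vectors, [L] sends the k-th basis vector to the k-th row of [H], which is the index
   order of [hessian]. *)
pose L : {linear V -> V} := mulmxr H.
have LE h i : L h 0 i = \sum_(j < d) h 0 j * H j i by rewrite /L /= mxE.
have hL h : `|L h| <= (\sum_j \sum_i `|H j i|) * `|h|.
  apply: ler_norm_coord; first by rewrite mulr_ge0// sumr_ge0// => j _; rewrite sumr_ge0.
  move=> k i; rewrite ord1 LE; apply: le_trans (ler_norm_sum _ _ _) _.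
  rewrite mulr_suml ler_sum// => j _; rewrite normrM mulrC.
  apply: ler_pM => //; last exact: ler_coord_norm.
  by rewrite (bigD1 i)//= lerDl sumr_ge0.
have r2 : 0 < r / 2 by rewrite divr_gt0.
have [dg dgE] : differentiable (grad f) 0 /\ 'd (grad f) 0 = L :> (V -> V).
  apply: (quadratic_is_diff (K := K2) r2 hL) => h hr.
  have hr' : `|h| < r by apply: le_lt_trans hr _; rewrite ltr_pdivrMr// ltr_pMr// ltr1n.
  rewrite add0r grad0 gradE//; apply: ler_norm_coord; first by rewrite mulr_ge0// exprn_ge0.
  move=> k i; rewrite ord1.
  have -> : (\row_i a i h - a0 - L h) 0 i = a i h - (a0 0 i + \sum_(j < d) h 0 j * H j i).
    by rewrite -LE; move: (L h) => u; rewrite !mxE opprD addrA.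
  exact: ha (ltW hr').
split => //.
- split => //; apply/nbhs_norm0P; exists r => //= t tr; exact: (df t tr).1.
- apply/matrixP => k l; rewrite mxE dgE LE (bigD1 k)//= big1.
    by rewrite mxE !eqxx mul1r addr0.
  by move=> j jk; rewrite mxE eqxx (negPf jk) mul0r.
Qed.

End SecondOrder.

(** * Expansion of the leading eigenvalue of an abstract matrix family *)

Section LeadingEigenvalueExpansion.
Variables (R : realType) (d p : nat).
Local Notation C := R[i].
Local Notation V := 'rV[R]_d.
Local Notation e := (const_mx 1 : 'cV[C]_p).
Local Open Scope classical_set_scope.

(** Eigenvectors are chosen pointwise, with no regularity assumed. Since dk = i m - sg t + O(t^2),
    the real part carries the Hessian and the imaginary part the gradient. *)
Lemma leading_eigenvalue_expansion (B : V -> 'M[C]_p) (dB : 'I_d -> V -> 'M[C]_p)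
    (ddB : 'I_d -> 'I_d -> 'M[C]_p) (pi : 'rV[C]_p) (m : 'I_d -> R) (sg : 'M[R]_d) (K : R)
    (k : V -> C) :
  0 <= K ->
  (forall t h, mxl1 (B (t + h) - B t - dirB dB t h) <= K * `|h| ^+ 2) ->
  (forall i t, mxl1 (dB i t) <= K) ->
  B 0 *m e = e -> pi *m B 0 = pi -> pi *m e = 1%:M ->
  (forall (v : 'cV[C]_p) z, B 0 *m v = z *: v -> v != 0 ->
    1 <= normc z -> z = 1 /\ exists a, v = const_mx a) ->
  (forall i t,
    mxl1 (dB i t - dB i 0 - \sum_(j < d) (t 0 j)%:C%C *: ddB j i) <= K * `|t| ^+ 2) ->
  (forall i, dB i 0 *m e = ('i%C * (m i)%:C%C) *: e) ->
  (forall i j, pi *m ddB i j *m e = (- (sg i j)%:C%C)%:M) ->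
  (\forall t \near (0 : V), leading_eigenvalue (B t) (k t)) ->
  [/\ twice_differentiable (fun t => complex.Re (k t)) 0,
      grad (fun t => complex.Re (k t)) 0 = 0 &
      hessian (fun t => complex.Re (k t)) 0 = - sg] /\
  [/\ twice_differentiable (fun t => complex.Im (k t)) 0,
      grad (fun t => complex.Im (k t)) 0 = \row_i m i &
      hessian (fun t => complex.Im (k t)) 0 = 0].
Proof.
move=> K0 B_taylor dB_bound Be piB pie B_per dB_taylor dBe ddBe /nbhs_norm0P[r1 /= r10 hk].
have [r2 r20 hr2] := leading_eigenvalue_near0 K0 B_taylor dB_bound Be piB pie B_per.
(* Halving r1 places the closed ball of radius r inside the open ball given by the hypothesis on
   [k]. *)
pose r := Num.min (r1 / 2) r2.
have r0 : 0 < r by rewrite lt_min r20 divr_gt0.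
have lead t : `|t| <= r -> leading_eigenvalue (B t) (k t).
  move=> tr; apply: hk => /=; apply: le_lt_trans tr _.
  by rewrite gt_min; apply/orP; left; rewrite ltr_pdivrMr// ltr_pMr// ltr1n.
have k_near t : `|t| <= r -> near_one B pi K (k t) t.
  move=> tr; apply: (hr2 t _).2 (lead t tr); apply: le_trans tr _.
  by rewrite ge_min lexx orbT.
have /choice [v v_norm] : forall t, exists v, `|t| <= r -> right_normalized B pi K (k t) t v.
  move=> t; have [tr|_] := boolP (`|t| <= r); last by exists 0.
  have /eigenvalue_colP [v Bv v0] := (lead t tr).1.
  have [c _ h] := right_normalize K0 B_taylor dB_bound Be piB pie B_per (k_near t tr) Bv v0.
  by exists (c *: v).
have /choice [l l_norm] : forall t, exists l, `|t| <= r -> left_normalized B pi K (k t) t l.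
  move=> t; have [tr|_] := boolP (`|t| <= r); last by exists 0.
  have /eigenvalueP [l lB l0] := (lead t tr).1.
  have [c _ h] := left_normalize K0 B_taylor dB_bound piB pie B_per (k_near t tr) lB l0.
  by exists (c *: l).
have [K1 K10 h1] := k_taylor K0 B_taylor dB_bound Be piB pie B_per k_near v_norm l_norm.
have /choice [K2 hK2] : forall i, exists K2, 0 <= K2 /\ forall t : V, `|t| <= r ->
    normc (dk dB v l i t - ('i%C * (m i)%:C%C - \sum_(j < d) (t 0 j * sg j i)%:C%C))
      <= K2 * `|t| ^+ 2.
  move=> i; have [K2 K20 h2] := dk_taylor K0 B_taylor dB_bound Be piB pie B_per (ltW r0)
    k_near v_norm l_norm dB_taylor dBe ddBe i.
  by exists K2.
(* Summing the constants gives one that is valid for all i. *)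
pose K3 := \sum_i K2 i.
have K30 : 0 <= K3 by rewrite sumr_ge0// => i _; have [] := hK2 i.
have h2 i t : `|t| <= r ->
    normc (dk dB v l i t - ('i%C * (m i)%:C%C - \sum_(j < d) (t 0 j * sg j i)%:C%C))
      <= K3 * `|t| ^+ 2.
  move=> tr; have [_ /(_ t tr) /le_trans] := hK2 i; apply.
  rewrite ler_wpM2r ?exprn_ge0// /K3 (bigD1 i)//= lerDl sumr_ge0// => j _.
  by have [] := hK2 j.
have ReB (x y : C) : complex.Re (x - y) = complex.Re x - complex.Re y by case: x; case: y.
have ImB (x y : C) : complex.Im (x - y) = complex.Im x - complex.Im y by case: x; case: y.
split.
- apply: (@twice_differentiable_bounds _ _ _ (fun i t => complex.Re (dk dB v l i t)) 0 (- sg) r K1 K3) => //.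
    move=> s t sr tr; apply: le_trans (h1 s t sr tr); apply: le_trans (ler_Re_normc _).
    rewrite !ReB Re_sum; under [in leRHS]eq_bigr do rewrite ReZ.
    exact: lexx.
  move=> i t tr; apply: le_trans (h2 i t tr); apply: le_trans (ler_Re_normc _).
  rewrite !ReB Re_sum mxE add0r.
  have -> : complex.Re ('i%C * (m i)%:C%C) = 0 by rewrite /= mul0r mul1r subr0.
  have -> : \sum_(j < d) t 0 j * (- sg) j i = 0 - \sum_(j < d) complex.Re (t 0 j * sg j i)%:C%C.
    by rewrite sub0r -sumrN; apply: eq_bigr => j _; rewrite mxE mulrN.
  exact: lexx.
- apply: (@twice_differentiable_bounds _ _ _ (fun i t => complex.Im (dk dB v l i t)) (\row_i m i) 0 r K1 K3) => //.
    move=> s t sr tr; apply: le_trans (h1 s t sr tr); apply: le_trans (ler_Im_normc _).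
    rewrite !ImB Im_sum; under [in leRHS]eq_bigr do rewrite ImZ.
    exact: lexx.
  move=> i t tr; apply: le_trans (h2 i t tr); apply: le_trans (ler_Im_normc _).
  rewrite !ImB Im_sum mxE.
  have -> : complex.Im ('i%C * (m i)%:C%C) = m i by rewrite /= mul0r mul1r add0r.
  rewrite [X in m i - X]big1// subr0 big1 ?addr0// => j _.
  by rewrite mxE mulr0.
Qed.

End LeadingEigenvalueExpansion.

(** * Change of section and the gauged Fourier transform *)

Section Gauge.
Variables (R : realType) (d p : nat).
Local Notation C := R[i].
Local Notation V := 'rV[R]_d.

Lemma leading_eigenvalue_char_poly (A B : 'M[C]_p) z : char_poly A = char_poly B ->
  leading_eigenvalue A z -> leading_eigenvalue B z.
Proof.
move=> AB [ez [mz lz]]; split; first by rewrite eigenvalue_root_char -AB -eigenvalue_root_char.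
split => [|z' ez']; first by rewrite -AB.
by apply: lz; rewrite eigenvalue_root_char AB -eigenvalue_root_char.
Qed.

Lemma expi_neq0 (a : R) : expi a != 0.
Proof. by rewrite -normc_eq0 normc_expi oner_eq0. Qed.

Variables (mu : 'I_p -> 'I_p -> 'rV[int]_d -> R) (g : 'M[R]_(p, d)).
Hypothesis mu_ge0 : forall i j x, 0 <= mu i j x.
Hypothesis mu_exp : exp_moments mu.

(** It dominates the l1 norm of the shifted jump, and the summand 1 makes it at least 1, as the
    Taylor estimates require. *)
Definition gauge_weight (i j : 'I_p) (x : 'rV[int]_d) : R :=
  1 + (l1norm R x + \sum_(k < d) (`|g j k| + `|g i k|)).

Lemma gauge_weight_ge1 i j x : 1 <= gauge_weight i j x.
Proof.
rewrite lerDl addr_ge0 ?sumr_ge0// => k _; by rewrite addr_ge0.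
Qed.

Lemma gpt_le i j x : \sum_(k < d) `|gpt g i j x 0 k| <= gauge_weight i j x.
Proof.
rewrite /gauge_weight /l1norm -big_split/= ler_wpDl// ler_sum// => k _.
rewrite !mxE; apply: le_trans (ler_normD _ _) _; rewrite addrA lerD2r.
by apply: le_trans (ler_normD _ _) _; rewrite normrN.
Qed.

(** Bound n^3 by 6 exp(n) and split off the constant part G of n; the exponential moment of order 1
    suffices. *)
Lemma gauge_weight_summable i j :
  abs_summable (fun x => gauge_weight i j x ^+ 3 * mu i j x).
Proof.
pose G := 1 + \sum_(k < d) (`|g j k| + `|g i k|).
have se : abs_summable (fun x => expR (1 * l1norm R x) * mu i j x).
  rewrite /abs_summable; under eq_esum do rewrite ger0_norm ?mulr_ge0 ?expR_ge0//.
  exact: mu_exp.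
apply: abs_summable_le (abs_summableZ (6 * expR G) se) => x.
have n0 : 0 <= gauge_weight i j x by apply: le_trans (gauge_weight_ge1 i j x).
rewrite ger0_norm ?mulr_ge0 ?exprn_ge0// mulrA ler_wpM2r// -mulrA -expRD mul1r.
have -> : G + l1norm R x = gauge_weight i j x by rewrite /G /gauge_weight; ring.
(* The index 2 yields the term n^3 / 3!, whence the factor 6. *)
have := expR_ge1Dxn 2 n0; rewrite (_ : 3`! = 6)%N//; lra.
Qed.

Definition gauged (t : V) : 'M[C]_p := \matrix_(i, j) fourier (gpt g i j) (mu i j) t.
Definition dgauged (l : 'I_d) (t : V) : 'M[C]_p :=
  \matrix_(i, j) dfourier (gpt g i j) (mu i j) l t.
Definition ddgauged (k l : 'I_d) : 'M[C]_p :=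
  \matrix_(i, j) ddfourier (gpt g i j) (mu i j) k l.

Definition gauged_moment : R :=
  \sum_i \sum_j 4 * rsum (fun x => gauge_weight i j x ^+ 3 * mu i j x).

Lemma gauged_moment_ge0 : 0 <= gauged_moment.
Proof.
rewrite sumr_ge0// => i _; rewrite sumr_ge0// => j _; rewrite mulr_ge0//.
exact: Mo_ge0 (mu_ge0 i j) (gauge_weight_ge1 i j) (gauge_weight_summable i j).
Qed.

Lemma gauged_moment_bound (X : 'M[C]_p) c :
  (forall i j, normc (X i j) <= 4 * rsum (fun x => gauge_weight i j x ^+ 3 * mu i j x) * c) ->
  mxl1 X <= gauged_moment * c.
Proof.
move=> h; rewrite /mxl1 /gauged_moment mulr_suml ler_sum// => i _.
by rewrite mulr_suml ler_sum// => j _; exact: h.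
Qed.

Lemma gauged_taylor t h :
  mxl1 (gauged (t + h) - gauged t - dirB dgauged t h) <= gauged_moment * `|h| ^+ 2.
Proof.
apply: gauged_moment_bound => i j.
have -> : (gauged (t + h) - gauged t - dirB dgauged t h) i j =
    fourier (gpt g i j) (mu i j) (t + h) - fourier (gpt g i j) (mu i j) t
    - \sum_(l < d) (h 0 l)%:C%C * dfourier (gpt g i j) (mu i j) l t.
  rewrite !mxE summxE; congr (_ - _); apply: eq_bigr => l _; by rewrite !mxE.
exact: fourier_taylor (mu_ge0 i j) (gauge_weight_ge1 i j) (gpt_le i j) (gauge_weight_summable i j) _ _.
Qed.

Lemma dgauged_taylor l t :
  mxl1 (dgauged l t - dgauged l 0 - \sum_(k < d) (t 0 k)%:C%C *: ddgauged k l)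
    <= gauged_moment * `|t| ^+ 2.
Proof.
apply: gauged_moment_bound => i j.
have -> : (dgauged l t - dgauged l 0 - \sum_(k < d) (t 0 k)%:C%C *: ddgauged k l) i j =
    dfourier (gpt g i j) (mu i j) l t - dfourier (gpt g i j) (mu i j) l 0
    - \sum_(k < d) (t 0 k)%:C%C * ddfourier (gpt g i j) (mu i j) k l.
  rewrite !mxE summxE; congr (_ - _); apply: eq_bigr => k _; by rewrite !mxE.
exact: dfourier_taylor (mu_ge0 i j) (gauge_weight_ge1 i j) (gpt_le i j) (gauge_weight_summable i j) _ _.
Qed.

Lemma dgauged_bound l t : mxl1 (dgauged l t) <= gauged_moment.
Proof.
rewrite -[leRHS]mulr1; apply: gauged_moment_bound => i j; rewrite mxE mulr1.
exact: dfourier_bound (mu_ge0 i j) (gauge_weight_ge1 i j) (gpt_le i j) (gauge_weight_summable i j) _ _.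
Qed.

Lemma mu_summable i j : abs_summable (mu i j).
Proof.
apply: abs_summable_le (gauge_weight_summable i j) => x.
by rewrite ger0_norm// ler_peMl// exprn_ege1// gauge_weight_ge1.
Qed.

Lemma muhatE t i j : muhat mu t i j =
  csum (fun x => expi (dotz x t) * (mu i j x)%:C%C).
Proof.
rewrite mxE /csum; congr Complex; congr rsum; apply/funext => x /=; ring.
Qed.

Lemma dotr_gpt i j x t :
  dotr (gpt g i j x) t + dotr (row j g) t = dotr (row i g) t + dotz x t.
Proof.
rewrite /dotr /dotz -!big_split/=; apply: eq_bigr => k _; rewrite !mxE; ring.
Qed.

(** Conjugation by the diagonal matrix of entries exp(i g_i.t) turns the phase x.t into that of the
    shifted point x - g_j + g_i. *)
Lemma char_poly_gauged t : char_poly (muhat mu t) = char_poly (gauged t).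
Proof.
pose D : 'M[C]_p := diag_mx (\row_i expi (dotr (row i g) t)).
apply: (@char_poly_conj _ _ _ _ D).
  rewrite unitmxE unitfE det_diag; apply/prodf_neq0 => i _; rewrite mxE; exact: expi_neq0.
rewrite mul_diag_mx mul_mx_diag; apply/matrixP => i j.
rewrite !mxE -[Complex _ _](_ : muhat mu t i j = _); last by rewrite mxE.
have s0 (f : 'rV[int]_d -> R) : cabs_summable (fun x => expi (f x) * (mu i j x)%:C%C).
  apply: cabs_summable_le (mu_summable i j) => x.
  by rewrite normcM normc_expi mul1r normc_real ger0_norm.
rewrite muhatE -csumZ// /fourier [RHS]mulrC -csumZ//.
by congr csum; apply/funext => x; rewrite !mulrA -!expiD [dotr (row j g) t + _]addrC dotr_gpt.
Qed.

Lemma gauged0 : gauged 0 = map_mx (real_complex R) (transM mu).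
Proof. by apply/matrixP => i j; rewrite !mxE fourier0. Qed.

Hypothesis mu_mass : forall i, (\sum_(j < p) \esum_(x in [set: 'rV[int]_d]) (mu i j x)%:E = 1)%E.

Lemma transM_sum i : \sum_j transM mu i j = 1.
Proof.
apply: EFin_inj; rewrite -sumEFin -[RHS](mu_mass i); apply: eq_bigr => j _.
by rewrite mxE rsum_ge0E ?fineK ?abs_summable_fin//; exact: mu_summable.
Qed.

Lemma gauged0_const1 : gauged 0 *m const_mx 1 = const_mx 1 :> 'cV[C]_p.
Proof.
apply/matrixP => i j; rewrite gauged0 ord1 map_mulmx_col [RHS]mxE.
under eq_bigr do rewrite [const_mx _ _ _]mxE mulr1.
by rewrite -rmorph_sum/= transM_sum.
Qed.

Lemma transM_ge0 i j : 0 <= transM mu i j.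
Proof.
rewrite mxE rsum_ge0E//; last exact: mu_summable.
by apply: fine_ge0; apply: esum_ge0 => x _; rewrite lee_fin.
Qed.

Lemma transM_gt0 i j x : 0 < mu i j x -> 0 < transM mu i j.
Proof. by move=> h; rewrite mxE; apply: rsum_gt0 h => //; exact: mu_summable. Qed.

Variable pi : 'rV[R]_p.

(** Appropriateness enters here: the row sums of the gauged drifts all equal the global drift, so
    the constant column is mapped to a multiple of itself. *)
Lemma dgauged0_const1 l : appropriate mu pi g ->
  dgauged l 0 *m const_mx 1 = ('i%C * (drift mu pi 0 l)%:C%C) *: const_mx 1 :> 'cV[C]_p.
Proof.
move=> app; apply/matrixP => i j; rewrite ord1 !mxE mulr1 -(app i) summxE rmorph_sum/= mulr_sumr.
by apply: eq_bigr => k _; rewrite !mxE mulr1 dfourier0.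
Qed.

Lemma ddgauged_energy k l :
  map_mx (real_complex R) pi *m ddgauged k l *m const_mx 1 =
  (- (energy mu pi g k l)%:C%C)%:M :> 'M[C]_1.
Proof.
apply/matrixP => a b; rewrite !ord1 [RHS]mxE mulr1n mxE /energy mxE.
under eq_bigr do rewrite !mxE mulr1.
rewrite exchange_big/= rmorph_sum/= -sumrN; apply: eq_bigr => i _.
rewrite rmorph_sum/= -sumrN; apply: eq_bigr => j _.
by rewrite !mxE ddfourierE rmorphM/= mulrN.
Qed.

End Gauge.

(** * Gradient and Hessian of the leading eigenvalue of [muhat] *)

Theorem theorem2p9 (R : realType) (d p : nat)
    (mu : 'I_p -> 'I_p -> 'rV[int]_d -> R) (pi : 'rV[R]_p) (g : 'M[R]_(p, d)) :
  (0 < d)%N -> (0 < p)%N ->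
  is_MAP_kernel mu -> MAP_irreducible mu -> MAP_aperiodic mu -> exp_moments mu ->
  stationary mu pi -> appropriate mu pi g ->
  (exists k : 'rV[R]_d -> R[i],
      \forall t \near (0 : 'rV[R]_d), leading_eigenvalue (muhat mu t) (k t)) /\
  (forall k : 'rV[R]_d -> R[i],
      (\forall t \near (0 : 'rV[R]_d), leading_eigenvalue (muhat mu t) (k t)) ->
      twice_differentiable (fun t => complex.Re (k t)) 0 /\
      twice_differentiable (fun t => complex.Im (k t)) 0 /\
      (* gradient of k at 0 is i m *)
      grad (fun t => complex.Re (k t)) 0 = 0 /\
      grad (fun t => complex.Im (k t)) 0 = drift mu pi /\
      (* Hessian of k at 0 is - sigma *)
      hessian (fun t => complex.Re (k t)) 0 = - energy mu pi g /\
      hessian (fun t => complex.Im (k t)) 0 = 0).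
Proof.
move=> _ _ [mu0 mu1] irr aper mexp [pi0 [pi1 piP]] app.
pose piC := map_mx (real_complex R) pi.
have cp t := char_poly_gauged g mu0 mexp t.
have K0 := gauged_moment_ge0 g mu0 mexp.
have Be := gauged0_const1 g mu0 mexp mu1.
have piB : piC *m gauged mu g 0 = piC by rewrite gauged0 -map_mxM piP.
have pie : piC *m const_mx 1 = 1%:M.
  apply/matrixP => i j; rewrite !ord1 !mxE; under eq_bigr do rewrite !mxE mulr1.
  by rewrite -rmorph_sum/= pi1.
have per (v : 'cV[R[i]]_p) z : gauged mu g 0 *m v = z *: v -> v != 0 ->
    1 <= normc z -> z = 1 /\ exists a, v = const_mx a.
  rewrite gauged0; apply: (MAP_peripheral_eigen _ _ _ irr aper).
  - exact: transM_ge0.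
  - exact: transM_sum.
  - exact: transM_gt0.
have taylor := gauged_taylor g mu0 mexp; have bound := dgauged_bound g mu0 mexp.
split.
  have [r r0 hr] := leading_eigenvalue_near0 K0 taylor bound Be piB pie per.
  have /choice [k hk] : forall t : 'rV[R]_d, exists z, `|t| <= r ->
      leading_eigenvalue (muhat mu t) z.
    move=> t; have [tr|_] := boolP (`|t| <= r); last by exists 0.
    have [[z hz] _] := hr t tr; exists z => _.
    exact: leading_eigenvalue_char_poly (esym (cp t)) hz.
  by exists k; apply/nbhs_norm0P; exists r => //= t tr; apply: hk; exact: ltW.
move=> k hk.
(* Being a leading eigenvalue depends on the characteristic polynomial alone, so [k] serves the
   gauged family as well. *)
have hk' : \forall t \near (0 : 'rV[R]_d), leading_eigenvalue (gauged mu g t) (k t).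
  by apply: filterS hk => t; exact: leading_eigenvalue_char_poly (cp t).
have [[h1 h2 h3] [h4 h5 h6]] := leading_eigenvalue_expansion K0 taylor bound Be piB pie per
  (dgauged_taylor g mu0 mexp) (fun l => dgauged0_const1 l app) (ddgauged_energy mu g pi) hk'.
have rowE : \row_i drift mu pi 0 i = drift mu pi by apply/rowP => i; rewrite mxE.
rewrite rowE in h5.
exact: (conj h1 (conj h4 (conj h2 (conj h5 (conj h3 h6))))).
Qed.
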